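(* There exists an absolute constant $C$ such that for all positive integers $r,n$ with $r\leq n/2$, every $n$-vertex graph with average degree at least $Cr\log(n/r)$ contains an $r$-regular subgraph.
   Context: All graphs are finite and simple with non-empty vertex sets. Logarithms are to base $2$. An $r$-regular subgraph is a subgraph (with non-empty vertex set) in which every vertex has degree exactly $r$. *)

(* Defs.v *)
From HB Require Import structures.
From mathcomp Require Import all_boot all_order all_algebra.
From mathcomp Require Import reals exp.

Set Implicit Arguments.
Unset Strict Implicit.
Unset Printing Implicit Defensive.

Import Order.TTheory GRing.Theory Num.Theory.
Local Open Scope ring_scope.

(* The vertex set is a subset of the carrier V, so that a subgraph of a graph
   on V is again a graph on V. *)
Record sgraph (V : finType) := SGraph {
  vertices : {set V};
  adj : rel V;
  vertices_neq0 : vertices != set0;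
  adj_vertices : forall x y, adj x y -> (x \in vertices) && (y \in vertices);
  adj_sym : symmetric adj;
  adj_irr : irreflexive adj
}.

Definition subgraph (V : finType) (H G : sgraph V) : Prop :=
  vertices H \subset vertices G /\ subrel (adj H) (adj G).

Definition degree (V : finType) (G : sgraph V) (x : V) : nat :=
  #|[set y | adj G x y]|.

Definition regular (V : finType) (r : nat) (G : sgraph V) : Prop :=
  forall x, x \in vertices G -> degree G x = r.

Definition average_degree (R : realType) (V : finType) (G : sgraph V) : R :=
  (\sum_(x in vertices G) degree G x)%N%:R / #|vertices G|%:R.

Definition log2 (R : realType) (x : R) : R := ln x / ln 2.

(* Main.v *)
Require Import Defs.
From HB Require Import structures.
From mathcomp Require Import all_boot all_order all_algebra.
From mathcomp Require Import reals exp.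
From mathcomp Require Import ring lra zify.

Set Implicit Arguments.
Unset Strict Implicit.
Unset Printing Implicit Defensive.

Import Order.TTheory GRing.Theory Num.Theory.

(** Pass to a bipartite subgraph of large minimum degree with sides A and B, |B| <= |A|.
A minimal nonempty A' in A with |N(A')| <= |A'| is perfectly matched to N(A'); remove this
matching and repeat inside A'. Of the O(log(n/r)) consecutive blocks of t = O(r) nested
matchings, one loses only a 1/16 fraction of its vertices, and the union of its matchings is
a bipartite graph of maximum degree t in which all but 1/16 of the degrees equal t.

Give its edges weight 1/t, so that weighted degrees are at most 1, and call 1 minus the
weighted degree the deficit of a vertex. Deleting every vertex independently with
probability equal to its (capped) deficit and rescaling the surviving edges makes every
expected degree equal to 1; if the average deficit is d and the weights are O(1/t), then the
variance is O(d/t). Hence, after truncation, O(log t) such rounds bring the average deficit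
down to O(1/t), while the caps on the deletion probabilities form a geometric series, so
that the weights remain O(1/t). Only second moments are used.

Scaling the weights by m = 2q - 1, where q is a power of 2 between r and 2r, and rounding
them to 0 and 1 gives a graph of maximum degree at most 2q - 1 and average degree more than
2q - 2. By the argument of Alon, Friedland and Kalai it has a q-regular subgraph, which is
bipartite, so rounding the constant weight r/q on it gives an r-regular subgraph. *)

(** * Degrees divisible by a power of 2 *)

(** By Pascal's rule each ['C(s, i)] with [i < q - 1] is counted twice, so only ['C(s, q - 1)]
    survives modulo 2. *)
Lemma odd_sum_bin s q : 0 < q ->
  odd (\sum_(i < q) 'C(s.+1, i)) = odd 'C(s, q.-1).
Proof.
case: q => // q _ /=; elim: q => [|q IHq]; first by rewrite big_ord1 !bin0.
by rewrite big_ord_recr /= oddD IHq binS oddD addbC -addbA addbb addbF.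
Qed.

Lemma odd_sum_bin_pow2 k s : s < 2 * 2 ^ k ->
  odd (\sum_(i < 2 ^ k) 'C(s, i)) -> s = 0 \/ s = 2 ^ k.
Proof.
have q_gt0 : 0 < 2 ^ k by rewrite expn_gt0.
case: s => [|s lts]; first by left.
rewrite odd_sum_bin // => oddC; right.
set q := 2 ^ k in q_gt0 lts oddC *.
have leqs : q.-1 <= s.
  by rewrite leqNgt; apply/negP => h; rewrite bin_small in oddC.
have [u ltuq es] : exists2 u, u < q & s = q.-1 + u.
  by exists (s - q.-1); lia.
case: u => [|u] in ltuq es *; first by rewrite es; lia.
(* Here [s] exceeds [q - 1] by [u + 1], and ['C(s, u + 1) = 'C(s, q - 1)] is odd; the identity then
   forces [q] to divide [u + 1 < q]. *)
have eqC : u.+1 * 'C(s, u.+1) = q * 'C(s, u).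
  by rewrite mul_bin_left; congr (_ * _); lia.
have eqC2 : 'C(s, u.+1) = 'C(s, q.-1).
  by rewrite -bin_sub; [congr 'C(_, _); lia | lia].
rewrite eqC2 in eqC.
have : q %| u.+1 by rewrite -(@Gauss_dvdl _ _ 'C(s, q.-1)) ?eqC ?dvdn_mulr // /q coprimeXl // coprime2n.
by move=> /dvdn_leq; lia.
Qed.

Section AFK.
Variables (T V : finType).

(** Adding or removing a fixed element of [E] outside [U] pairs up the sets of the interval. *)
Lemma even_card_interval (U E : {set T}) : ~~ (E \subset U) ->
  ~~ odd #|[set x in powerset E | U \subset x]|.
Proof.
case/subsetPn => e eE eU.
set X := [set x in _ | _].
pose X0 := [set x in X | e \notin x].
have -> : X = X0 :|: [set e |: x | x in X0].
  apply/setP => x; rewrite in_setU; apply/idP/orP.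
    move=> xX; have [ex|ex] := boolP (e \in x); last by left; rewrite inE xX ex.
    right; apply/imsetP; exists (x :\ e); last by rewrite setD1K.
    rewrite !inE eqxx /= andbT; move: xX; rewrite !inE => /andP[xE Ux].
    rewrite (subset_trans (subD1set _ _) xE) /=.
    apply/subsetP => z zU; rewrite !inE (subsetP Ux) // andbT.
    by apply: contraNneq eU => <-.
  case=> [|/imsetP[z]]; first by rewrite inE => /andP[].
  rewrite !inE => /andP[/andP[zE Uz] ez] ->.
  rewrite subUset sub1set eE zE /=.
  by rewrite (subset_trans Uz) ?subsetUr.
rewrite cardsU card_in_imset.
  rewrite [_ :&: _](_ : _ = set0) ?cards0 ?subn0 ?addnn ?odd_double //.
  apply/setP => x; rewrite in_setI in_set0; apply/negP => /andP[].
  rewrite inE => /andP[_ ex] /imsetP[z _ xE].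
  by move: ex; rewrite xE !inE eqxx.
move=> x y; rewrite !inE => /andP[_ ex] /andP[_ ey] exy.
by rewrite -(setU1K ex) exy setU1K.
Qed.

Lemma card_small_subsets (A : {set T}) q :
  \sum_(S : {set T} | (#|S| < q) && (S \subset A)) 1 = \sum_(i < q) 'C(#|A|, i).
Proof.
elim: q => [|q IHq]; first by rewrite big_ord0 big1 // => S.
rewrite big_ord_recr /= -IHq -cards_draws -sum1_card.
rewrite (bigID (fun S : {set T} => #|S| < q)) /=; congr (_ + _).
  by apply: eq_bigl => S; rewrite andbC; case: (ltngtP #|S| q) => h; lia.
apply: eq_bigl => S; rewrite inE; case: (S \subset A) => //=; lia.
Qed.

Variable (inc : T -> V -> bool).
Definition star (x : {set T}) v := [set f in x | inc f v].

(* The [i]-subsets of the star of [v] in [x] make [\sum_(i < q) 'C(#|star x v|, i)] a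
   polynomial of degree [q - 1] in the indicator of [x]; modulo [2] a polynomial of
   degree less than [#|E|] sums to [0] over all subsets of [E]. *)
Lemma divisible_degrees k (E : {set T}) (X : {set V}) :
  (2 ^ k - 1) * #|X| < #|E| ->
  (forall v, v \in X -> #|star E v| < 2 * 2 ^ k) ->
  exists x : {set T}, [/\ x \subset E, x != set0 &
    forall v, v \in X -> #|star x v| = 0 \/ #|star x v| = 2 ^ k].
Proof.
move=> ltE degE; set q := 2 ^ k in ltE degE *.
have q_gt0 : 0 < q by rewrite expn_gt0.
pose F (x : {set T}) := \prod_(v in X) \sum_(i < q) 'C(#|star x v|, i).
have evF : ~~ odd (\sum_(x in powerset E) F x).
  have FE x : F x = \sum_(f in pffun_on set0 (mem X) [pred S : {set T} | #|S| < q])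
     \prod_(v in X) (f v \subset star x v : nat).
    rewrite -(big_distr_big set0 (mem X) [pred S : {set T} | #|S| < q]
      (fun v S => S \subset star x v : nat)).
    apply: eq_bigr => v _; rewrite -card_small_subsets.
    by rewrite big_mkcondr; apply: eq_bigr => S _; case: ifP.
  under eq_bigr do rewrite FE.
  rewrite exchange_big /=.
  elim/big_rec: _ => // f n /pffun_onP[_ fP] evn; rewrite oddD (negbTE evn) addbF.
  (* [f] is one monomial: it picks fewer than [q] elements at each [v]. If all of them are incident
     with their [v], its value at [x] is 1 exactly when [x] contains [U]; otherwise it vanishes
     everywhere. *)
  pose U := \bigcup_(v in X) f v.
  have ltU : #|U| < #|E|.
    apply: leq_ltn_trans ltE.
    rewrite /U mulnC -sum_nat_const.
    apply: (@big_ind2 {set T} nat (fun A n => #|A| <= n)); rewrite ?cards0 //.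
      move=> A m B p Am Bp; apply: leq_trans (leq_add Am Bp).
      by rewrite cardsU leq_subr.
    move=> v vX; have : f v \in [pred S : {set T} | #|S| < q] by apply: fP; apply: image_f.
    rewrite inE; lia.
  have nEU : ~~ (E \subset U) by apply: contraL ltU => /subset_leq_card; rewrite leqNgt.
  have [/forallP inV|ninc] := boolP [forall v, (v \in X) ==> [forall e, (e \in f v) ==> inc e v]].
    rewrite (_ : \sum_(x in powerset E) _ = #|[set x in powerset E | U \subset x]|).
      exact: even_card_interval.
    rewrite -sum1_card [RHS](eq_bigl (fun x => (x \in powerset E) && (U \subset x))); last by move=> x; rewrite inE.
    rewrite big_mkcondr; apply: eq_bigr => x _; case: ifP => Ux.
      rewrite big1 // => v vX; apply/eqP; rewrite eqb1; apply/subsetP => e ef.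
      rewrite inE (subsetP Ux) ?(implyP (forallP (implyP (inV v) vX) e)) //.
      by apply/bigcupP; exists v.
    move/negbT/subsetPn: Ux => [e /bigcupP[v vX ef] ex].
    rewrite (bigD1 v) //= (_ : (_ \subset _) = false) //; apply: contraNF ex.
    by move=> /subsetP/(_ _ ef); rewrite inE => /andP[].
  rewrite big1 // => x _.
  move: ninc => /forallPn[v]; rewrite negb_imply => /andP[vX /forallPn[e]].
  rewrite negb_imply => /andP[ef ninc].
  rewrite (bigD1 v) //= (_ : (_ \subset _) = false) //; apply: contraNF ninc.
  by move=> /subsetP/(_ _ ef); rewrite inE => /andP[].
(* [F] is odd at the empty set but has an even sum, so it is odd at a nonempty subset of [E] too,
   and there every factor is odd. *)
have F0 : F set0 = 1.
  apply: big1 => v _; rewrite (_ : star _ _ = set0); last first.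
    by apply/setP => e; rewrite !inE.
  case: (q) q_gt0 => // p _; rewrite cards0 big_ord_recl bin0 big1 // => i _.
have [x xE] : exists x, (x \in powerset E :\ set0) && odd (F x).
  apply/existsP; apply: contraR evF => /existsPn evF.
  rewrite (bigD1 set0) ?powersetE ?sub0set //= F0 oddD /=.
  elim/big_rec: _ => // x n /andP[xE x0] evn; rewrite oddD.
  by move: (evF x); rewrite in_setD1 x0 xE /= => /negbTE ->.
move: xE; rewrite !inE => /andP[/andP[x0 xE] oddF].
exists x; split => // v vX; apply: odd_sum_bin_pow2.
  apply: leq_ltn_trans (degE v vX); apply/subset_leq_card/subsetP => e.
  by rewrite !inE => /andP[/(subsetP xE) -> ->].
by move: oddF; rewrite /F (bigD1 v) //= oddM => /andP[].
Qed.
End AFK.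

(** * Nested matchings *)

Section Matchings.
Variable V : finType.
Implicit Types (E F : rel V) (A B S : {set V}).

(** Bipartite graphs appear as relations directed from the left to the right side; left degrees are
    out-degrees and right degrees in-degrees. *)
Definition nbr E A := [set b | [exists a in A, E a b]].
Definition outdeg E a := #|[set b | E a b]|.
Definition indeg E b := #|[set a | E a b]|.

Lemma nbrP E A b : reflect (exists2 a, a \in A & E a b) (b \in nbr E A).
Proof. by rewrite inE; apply: exists_inP. Qed.

Lemma nbrS E A B : A \subset B -> nbr E A \subset nbr E B.
Proof.
move=> /subsetP AB; apply/subsetP => b /nbrP[a aA Eab].
by apply/nbrP; exists a => //; apply: AB.
Qed.

(** Hall's marriage theorem, by induction on the size of [A]; the two cases depend on whether some
    nonempty proper subset is tight. *)
Lemma hall E A : (forall S, S \subset A -> #|S| <= #|nbr E S|) ->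
  exists f, {in A &, injective f} /\ {in A, forall a, E a (f a)}.
Proof.
have [m] := ubnP #|A|; elim: m A E => // m IHm A E; rewrite ltnS => leA hallA.
have [->|/set0Pn[a aA]] := eqVneq A set0.
  by exists id; split=> x; rewrite inE.
have [/existsP[S /and4P[SA S0 nSA /eqP eS]]|noS] := boolP [exists S : {set V},
    [&& S \subset A, S != set0, S != A & #|nbr E S| == #|S|]].
  have ltS : #|S| < #|A| by rewrite proper_card // properEneq nSA.
  have [f [finj fE]] : exists f, {in S &, injective f} /\ {in S, forall a, E a (f a)}.
    apply: IHm; first exact: leq_trans ltS leA.
    by move=> S' S'S; apply: hallA; apply: subset_trans S'S SA.
  (* The rest of [A] is matched outside [nbr E S]. Hall's condition survives there, because the
     tight [S] accounts for exactly [#|S|] neighbours. *)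
  pose E' : rel V := fun x y => E x y && (y \notin nbr E S).
  have [||g [ginj gE]] := IHm (A :\: S) E'.
  - apply: leq_trans leA; rewrite -(cardsID S A) (setIidPr SA).
    by rewrite -[X in X < _]add0n ltn_add2r card_gt0.
  - move=> S' S'A.
    have -> : nbr E' S' = nbr E (S' :|: S) :\: nbr E S.
      apply/setP => b; rewrite [RHS]inE; apply/nbrP/andP.
        case=> x xS' /andP[Exb bN]; split=> //; apply/nbrP; exists x => //.
        by rewrite inE xS'.
      case=> bN /nbrP[x]; rewrite inE => /orP[xS'|xS] Exb.
        by exists x => //; rewrite /E' Exb.
      by case/negP: bN; apply/nbrP; exists x.
    have disj : #|S' :|: S| = #|S'| + #|S|.
      rewrite cardsU (_ : S' :&: S = set0) ?cards0 ?subn0 //.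
      apply/setP => x; rewrite !inE; apply/negP => /andP[xS' xS].
      by have := subsetP S'A x xS'; rewrite inE xS.
    rewrite cardsD (setIidPr _) ?nbrS ?subsetUr // eS.
    have : S' :|: S \subset A.
      by rewrite subUset SA andbT (subset_trans S'A) ?subsetDl.
    by move/hallA; rewrite disj; lia.
  exists (fun x => if x \in S then f x else g x); split; last first.
    move=> x xA; case: ifP => [/fE//|xS].
    by have /gE/andP[] : x \in A :\: S by rewrite inE xS.
  have cross x y : x \in S -> y \in A -> y \notin S -> f x != g y.
    move=> xS yA yS; apply: contraTneq (fE x xS) => ->.
    have /gE/andP[_] : y \in A :\: S by rewrite inE yS.
    by apply: contra => Exy; apply/nbrP; exists x.
  move=> x y xA yA; case: (boolP (x \in S)) => xS; case: (boolP (y \in S)) => yS.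
  - exact: finj.
  - by move=> e; have := cross x y xS yA yS; rewrite e eqxx.
  - by move=> e; have := cross y x yS xA xS; rewrite e eqxx.
  - by apply: ginj; rewrite inE ?xS ?yS.
have [b Eab] : exists b, E a b.
  have : 0 < #|nbr E [set a]|.
    by apply: leq_trans (hallA [set a] _); rewrite ?cards1 ?sub1set.
  by rewrite card_gt0 => /set0Pn[b /nbrP[x /set1P->]]; exists b.
(* Without tight sets every nonempty proper subset has a spare neighbour and can afford to lose
   [b]. *)
pose E' : rel V := fun x y => E x y && (y != b).
have [||f [finj fE]] := IHm (A :\ a) E'.
- by apply: leq_trans leA; rewrite (cardsD1 a A) aA.
- move=> S SA; have [->|S0] := eqVneq S set0; first by rewrite cards0.
  have SA' : S \subset A by apply: subset_trans SA (subD1set _ _).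
  have nSA : S != A.
    by apply: contraTneq SA => ->; apply/subsetPn; exists a; rewrite // !inE eqxx.
  have lt : #|S| < #|nbr E S|.
    rewrite ltn_neqAle hallA // andbT eq_sym.
    by apply: contraNneq noS => e; apply/existsP; exists S; rewrite SA' S0 nSA e eqxx.
  have : nbr E S :\ b \subset nbr E' S.
    apply/subsetP => y; rewrite in_setD1 => /andP[yb /nbrP[x xS Exy]].
    by apply/nbrP; exists x => //; rewrite /E' Exy.
  by move/subset_leq_card; rewrite (cardsD1 b (nbr E S)) in lt; case: (b \in _) lt; lia.
exists (fun x => if x == a then b else f x); split; last first.
  move=> x xA; case: eqP => [->//|/eqP xa].
  by have /fE/andP[] : x \in A :\ a by rewrite !inE xa.
have cross x : x \in A -> x != a -> f x != b.
  by move=> xA xa; have /fE/andP[] : x \in A :\ a by rewrite !inE xa.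
move=> x y xA yA; case: (eqVneq x a) => [->|xa]; case: (eqVneq y a) => [->|ya] //.
- by move=> e; have := cross y yA ya; rewrite -e eqxx.
- by move=> e; have := cross x xA xa; rewrite e eqxx.
- by apply: finj; rewrite !inE ?xa ?ya.
Qed.

(* A minimal nonempty [A'] with at most [#|A'|] neighbours satisfies Hall's condition,
   with equality for [A'] itself. *)
Lemma perfect_matching E A : A != set0 -> #|nbr E A| <= #|A| ->
  (forall a, a \in A -> 0 < outdeg E a) ->
  exists A' f, [/\ A' != set0, A' \subset A, {in A' &, injective f},
    {in A', forall a, E a (f a)} & f @: A' = nbr E A'].
Proof.
move=> A0 leN deg.
pose P S := [&& S != set0, S \subset A & #|nbr E S| <= #|S|].
have PA : P A by rewrite /P A0 subxx.
case: (arg_minnP (fun S => #|S|) PA) => A' /and3P[A'0 A'A leA'] minA'.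
have [|f [finj fE]] := @hall E A'.
  move=> S SA'; have [->|S0] := eqVneq S set0; first by rewrite cards0.
  rewrite leqNgt; apply/negP => ltS.
  (* A set violating Hall's condition has at least two vertices, and dropping one of them leaves a
     smaller candidate than [A']. *)
  have [s sS] := set0Pn _ S0.
  have s_deg : 0 < #|nbr E S|.
    apply: leq_trans (deg s (subsetP A'A s (subsetP SA' s sS))) _.
    by apply/subset_leq_card/subsetP => b; rewrite !inE => Esb; apply/existsP; exists s; rewrite sS.
  have SsS := cardsD1 s S; rewrite sS in SsS.
  have : P (S :\ s).
    rewrite /P -card_gt0; apply/and3P; split; first by lia.
      by rewrite (subset_trans (subD1set _ _)) // (subset_trans SA').
    by apply: leq_trans (subset_leq_card (nbrS _ (subD1set _ _))) _; lia.
  by move/minA'; have := subset_leq_card SA'; lia.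
exists A', f; split=> //; apply/eqP; rewrite eqEcard; apply/andP; split.
  by apply/subsetP => b /imsetP[a aA' ->]; apply/nbrP; exists a => //; apply: fE.
by rewrite card_in_imset.
Qed.

(** Each round matches some [A1] perfectly with its neighbourhood, removes this matching and
    continues inside [A1]. Survivors of all rounds lie on all [t] matchings. A round costs one
    degree, so degrees stay positive throughout. *)
Lemma nested_matchings t E A B d : A != set0 -> #|A| = #|B| -> nbr E A \subset B ->
  (forall a, a \in A -> d + t <= outdeg E a) ->
  exists F A' B', [/\ [/\ A' != set0, A' \subset A, B' \subset B & #|A'| = #|B'|],
    nbr (fun a b => E a b && ~~ F a b) A' \subset B',
    forall a b, F a b -> [&& E a b, a \in A & b \in B],
    (forall a, outdeg F a <= t) /\ (forall b, indeg F b <= t) &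
    {in A', forall a, outdeg F a = t} /\ {in B', forall b, indeg F b = t}].
Proof.
elim: t E A B => [|t IHt] E A B A0 eAB EAB degE.
  have F0 (a : V) : #|[set b : V | false]| = 0 by apply: eq_card0 => b; rewrite inE.
  exists (fun _ _ => false), A, B; split=> //.
  - by apply: subset_trans EAB; apply/subsetP => b /nbrP[a aA]; rewrite andbT => Eab; apply/nbrP; exists a.
  - by split=> a; rewrite ?/outdeg ?/indeg F0.
  - by split=> a _; rewrite ?/outdeg ?/indeg F0.
have [||A1 [f [A10 A1A finj fE fA1]]] := @perfect_matching E A A0.
- by rewrite eAB; apply: subset_leq_card.
- by move=> a /degE; lia.
set B1 := nbr E A1 in fA1.
have B1B : B1 \subset B by apply: subset_trans EAB; apply: nbrS.
have eA1B1 : #|A1| = #|B1| by rewrite -fA1 card_in_imset.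
pose M : rel V := fun a b => (a \in A1) && (b == f a).
have ME a b : M a b -> E a b by case/andP => aA1 /eqP->; apply: fE.
pose E1 : rel V := fun a b => E a b && ~~ M a b.
have degM a : outdeg M a = (a \in A1).
  rewrite /outdeg /M; case: (a \in A1) => /=; last by apply: eq_card0 => b; rewrite inE.
  by rewrite -(cards1 (f a)); apply: eq_card => b; rewrite !inE.
have codegM b : indeg M b = (b \in B1).
  rewrite /indeg -fA1; case: imsetP => [[a aA1 ->]|nb].
    rewrite -[RHS](cards1 a); apply: eq_card => x; rewrite !inE /M.
    apply/andP/eqP => [[xA1 /eqP/esym e]|->]; last by rewrite aA1 eqxx.
    exact: finj.
  by apply: eq_card0 => x; rewrite inE; apply/negP => /andP[xA1 /eqP e]; apply: nb; exists x.
have [||F [A' [B' [[A'0 A'A1 B'B1 eA'B'] nbrF FE [degF codegF] [regF coregF]]]]] := IHt E1 A1 B1 A10 eA1B1.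
- by apply/subsetP => b /nbrP[a aA1 /andP[Eab _]]; apply/nbrP; exists a.
- move=> a aA1; have := degE a (subsetP A1A a aA1).
  have : outdeg E a <= outdeg E1 a + outdeg M a.
    rewrite /outdeg; apply: leq_trans (leq_card_setU _ _).
    apply/subset_leq_card/subsetP => b; rewrite !inE /E1 => ->.
    by case: (M a b).
  by rewrite degM aA1; lia.
pose F' : rel V := fun a b => M a b || F a b.
have MF a b : M a b -> F a b = false.
  by move=> Mab; apply/negP => /FE/and3P[]; rewrite /E1 Mab andbF.
have degF' a : outdeg F' a = outdeg M a + outdeg F a.
  rewrite /outdeg -cardsUI [X in _ + X](_ : _ = 0) ?addn0.
    by apply: eq_card => b; rewrite !inE.
  by apply: eq_card0 => b; rewrite !inE; case Mab: (M a b); rewrite ?(MF _ _ Mab).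
have codegF' b : indeg F' b = indeg M b + indeg F b.
  rewrite /indeg -cardsUI [X in _ + X](_ : _ = 0) ?addn0.
    by apply: eq_card => a; rewrite !inE.
  by apply: eq_card0 => a; rewrite !inE; case Mab: (M a b); rewrite ?(MF _ _ Mab).
exists F', A', B'; split.
- by split=> //; [exact: subset_trans A1A | exact: subset_trans B1B].
- apply: subset_trans nbrF; apply/subsetP => b /nbrP[a aA' /andP[Eab]].
  by rewrite negb_or => /andP[nM nF]; apply/nbrP; exists a; rewrite // /E1 Eab nM.
- move=> a b /orP[Mab|/FE/and3P[/andP[-> _] aA1 bB1]].
    have /andP[aA1 _] := Mab; rewrite ME // (subsetP A1A) //=.
    by apply: (subsetP B1B); apply/nbrP; exists a; rewrite ?ME.
  by rewrite (subsetP A1A) // (subsetP B1B).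
- split=> x; first by rewrite degF' degM -[t.+1]add1n leq_add ?leq_b1.
  by rewrite codegF' codegM -[t.+1]add1n leq_add ?leq_b1.
- split=> x xS.
    by rewrite degF' degM regF // (subsetP A'A1).
  by rewrite codegF' codegM coregF // (subsetP B'B1).
Qed.

(** If each of the [K] blocks loses more than 1/16 of its vertices, the sizes shrink by 15/16 every
    time, while a vertex of the last set still has [d] neighbours, which bounds that size from
    below. *)
Lemma almost_regular_block K t E A B d : A != set0 -> #|A| = #|B| -> nbr E A \subset B ->
  (forall a, a \in A -> d + K * t <= outdeg E a) -> 0 < d ->
  (exists F A0 B0 A' B', [/\ [/\ A0 != set0, #|A0| = #|B0|, A' \subset A0, B' \subset B0
        & #|A'| = #|B'|],
      [/\ A0 \subset A, B0 \subset B & 15 * #|A0| <= 16 * #|A'|],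
      forall a b, F a b -> [&& E a b, a \in A0 & b \in B0],
      (forall a, outdeg F a <= t) /\ (forall b, indeg F b <= t) &
      {in A', forall a, outdeg F a = t} /\ {in B', forall b, indeg F b = t}]) \/
  16 ^ K * d <= 15 ^ K * #|A|.
Proof.
elim: K E A B => [|K IHK] E A B A0 eAB EAB degE d0.
  right; rewrite !expn0 !mul1n eAB; case/set0Pn: A0 => a aA.
  have := degE a aA; rewrite mul0n addn0 => /leq_trans; apply.
  apply/subset_leq_card/subsetP => b; rewrite inE => Eab.
  by apply: (subsetP EAB); apply/nbrP; exists a.
have [|F [A' [B' [[A'0 A'A B'B eA'B'] nbrF FE degF regF]]]] :=
    @nested_matchings t E A B (d + K * t) A0 eAB EAB.
  by move=> a /degE; lia.
have [le|lt] := leqP (15 * #|A|) (16 * #|A'|).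
  by left; exists F, A, B, A', B'.
have [|[F' [A0' [B0' [A1 [B1 [S1 [S2a S2b S2] F'E S3 S4]]]]]]|le] :=
    IHK _ A' B' A'0 eA'B' nbrF _ d0.
- move=> a aA'; have := degE a (subsetP A'A a aA').
  have : outdeg E a <= outdeg (fun a b => E a b && ~~ F a b) a + outdeg F a.
    rewrite /outdeg; apply: leq_trans (leq_card_setU _ _).
    apply/subset_leq_card/subsetP => b; rewrite !inE => ->.
    by case: (F a b).
  by rewrite regF.1 //; lia.
- left; exists F', A0', B0', A1, B1; split=> //.
    by split=> //; [exact: subset_trans A'A | exact: subset_trans B'B].
  by move=> a b /F'E /and3P[/andP[-> _] -> ->].
right; rewrite !expnS -!mulnA; apply: leq_trans (leq_mul (leqnn 16) le) _.
rewrite mulnCA [15 * _]mulnCA leq_mul2l ltnW ?orbT //.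
Qed.
End Matchings.

Local Open Scope ring_scope.

(** * Rounding *)

(** There are more unknowns than equations, so a nonzero kernel vector exists; it is extended by
    zero outside [S]. *)
Lemma nontrivial_solution (F : fieldType) (T U : finType) (S : {set T}) (C : {set U})
    (a : U -> T -> F) : (#|C| < #|S|)%N ->
  exists x : T -> F, [/\ exists t, x t != 0, forall t, t \notin S -> x t = 0 &
    forall u, u \in C -> \sum_t a u t * x t = 0].
Proof.
move=> ltCS.
pose A := \matrix_(i < #|S|, j < #|C|) a (enum_val j) (enum_val i).
have : kermx A != 0.
  rewrite -mxrank_eq0 mxrank_ker -lt0n subn_gt0.
  exact: leq_ltn_trans (rank_leq_col A) ltCS.
case/rowV0Pn => v /sub_kermxP vA v0.
pose x t : F := \sum_(i < #|S|) (enum_val i == t)%:R * v 0 i.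
have xE i : x (enum_val i) = v 0 i.
  rewrite /x (bigD1 i) //= eqxx mul1r big1 ?addr0 // => j ji.
  by rewrite (inj_eq enum_val_inj) (negbTE ji) mul0r.
exists x; split.
- have [i vi] : exists i, v 0 i != 0.
    apply/existsP; apply: contraR v0 => /existsPn v0; apply/eqP/rowP => i.
    by rewrite mxE; apply/eqP; move: (v0 i); rewrite negbK.
  by exists (enum_val i); rewrite xE.
- move=> t tS; rewrite /x big1 // => i _; case: eqP => [e|]; last by rewrite mul0r.
  by rewrite -e enum_valP in tS.
- move=> u uC; have /matrixP/(_ 0 (enum_rank_in uC u)) := vA.
  rewrite !mxE => vA0; rewrite -[RHS]vA0.
  rewrite (bigID (mem S)) /= [X in _ + X]big1 ?addr0; last first.
    move=> t tS; rewrite /x big1 ?mulr0 // => i _; case: eqP => [e|]; last by rewrite mul0r.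
    by rewrite -e enum_valP in tS.
  rewrite big_enum_val; apply: eq_bigr => i _.
  by rewrite xE mxE enum_rankK_in // mulrC.
Qed.

Section Rounding.
Variables (R : archiRealFieldType) (I J : finType).
Implicit Types Z : I -> J -> R.

Definition nonint Z := [set f : I * J | Z f.1 f.2 \isn't a Num.int].

Lemma sum_nonint (K : finType) (z : K -> R) k : \sum_l z l \is a Num.int ->
  z k \isn't a Num.int -> exists2 l, l != k & z l \isn't a Num.int.
Proof.
move=> zs zk; apply/exists_inP; apply: contraR zk => /exists_inPn zl.
rewrite (bigD1 k) //= in zs; rewrite -(addrK (\sum_(l | l != k) z l) (z k)) rpredB //.
by apply: rpred_sum => l lk; have := zl l lk; rewrite negbK.
Qed.

(* Every row or column meeting the non-integral entries meets them twice, so the sum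
   conditions on these rows and columns, one of which is redundant, are fewer than the
   non-integral entries. *)
Lemma nonint_direction Z :
  (forall i, \sum_j Z i j \is a Num.int) -> (forall j, \sum_i Z i j \is a Num.int) ->
  nonint Z != set0 ->
  exists x : I -> J -> R, [/\ exists i j, x i j != 0,
    forall i j, Z i j \is a Num.int -> x i j = 0,
    forall i, \sum_j x i j = 0 & forall j, \sum_i x i j = 0].
Proof.
move=> rowZ colZ /set0Pn[[i0 j0] f0]; set S := nonint Z in f0.
pose rows := [set f.1 | f in S]; pose cols := [set f.2 | f in S].
have le_rows : (2 * #|rows| <= #|S|)%N.
  rewrite mulnC -sum_nat_const -[#|S|]sum1_card (partition_big_imset fst) /=.
  apply: leq_sum => i /imsetP[[i' j] fS ->] /=.
  have : Z i' j \isn't a Num.int by move: fS; rewrite inE.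
  case/(sum_nonint (rowZ i')) => l lj Zl.
  rewrite (bigD1 (i', j)) ?fS //= (bigD1 (i', l)) ?addnA ?leq_addr //=.
  by rewrite inE Zl eqxx /= xpair_eqE eqxx.
have le_cols : (2 * #|cols| <= #|S|)%N.
  rewrite mulnC -sum_nat_const -[#|S|]sum1_card (partition_big_imset snd) /=.
  apply: leq_sum => j /imsetP[[i j'] fS ->] /=.
  have : Z i j' \isn't a Num.int by move: fS; rewrite inE.
  case/(sum_nonint (colZ j')) => l li Zl.
  rewrite (bigD1 (i, j')) ?fS //= (bigD1 (l, j')) ?addnA ?leq_addr //=.
  by rewrite inE Zl eqxx /= xpair_eqE eqxx andbT.
pose C : {set I + J} := [set inl i | i in rows :\ i0] :|: [set inr j | j in cols].
have i0r : i0 \in rows by apply/imsetP; exists (i0, j0).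
have ltC : (#|C| < #|S|)%N.
  have : (#|C| <= #|rows :\ i0| + #|cols|)%N.
    apply: leq_trans (leq_card_setU _ _) _.
    by apply: leq_add; apply: leq_imset_card.
  by have := cardsD1 i0 rows; rewrite i0r; lia.
pose a (u : I + J) (f : I * J) : R :=
  match u with inl i => (f.1 == i)%:R | inr j => (f.2 == j)%:R end.
have [x [[[i j] xij] xS xC]] := nontrivial_solution a ltC.
have sum_row i' : \sum_f a (inl i') f * x f = \sum_j x (i', j).
  rewrite (eq_bigr (fun f => (f.1 == i')%:R * x (f.1, f.2))); last by case.
  rewrite -(pair_bigA _ (fun i j => (i == i')%:R * x (i, j))) /= (bigD1 i') //=.
  rewrite [X in _ + X]big1 ?addr0; last first.
    by move=> l /negbTE li; apply: big1 => m _; rewrite li mul0r.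
  by apply: eq_bigr => m _; rewrite eqxx mul1r.
have sum_col j' : \sum_f a (inr j') f * x f = \sum_i x (i, j').
  rewrite (eq_bigr (fun f => (f.2 == j')%:R * x (f.1, f.2))); last by case.
  rewrite -(pair_bigA _ (fun i j => (j == j')%:R * x (i, j))) /=.
  apply: eq_bigr => l _; rewrite (bigD1 j') //= eqxx mul1r big1 ?addr0 //.
  by move=> m /negbTE ->; rewrite mul0r.
have colx j' : \sum_i x (i, j') = 0.
  have [jc|jc] := boolP (j' \in cols); last first.
    rewrite big1 // => i' _; apply: xS; apply: contra jc => fS.
    by apply/imsetP; exists (i', j').
  rewrite -sum_col xC // inE; apply/orP; right; exact: imset_f.
have rowx i' : i' != i0 -> \sum_j x (i', j) = 0.
  move=> ii0; have [ir|ir] := boolP (i' \in rows); last first.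
    rewrite big1 // => j' _; apply: xS; apply: contra ir => fS.
    by apply/imsetP; exists (i', j').
  rewrite -sum_row xC // inE; apply/orP; left; apply: imset_f.
  by rewrite !inE ii0.
exists (fun i j => x (i, j)); split => //.
- by exists i, j.
- by move=> i' j' Zi; apply: xS; rewrite inE negbK.
- move=> i'; have [->|] := eqVneq i' i0; last exact: rowx.
  have : \sum_i \sum_j x (i, j) = 0 by rewrite exchange_big big1.
  by rewrite (bigD1 i0) //= [X in _ + X]big1 ?addr0.
Qed.

(** Ranging over all integers [k], this keeps each entry between its floor and its ceiling, in a
    form that is visibly transitive. *)
Definition rounds_to Z Z' := forall i j (k : int),
  (k%:~R <= Z i j -> k%:~R <= Z' i j) /\ (Z i j <= k%:~R -> Z' i j <= k%:~R).

(** Moving along a direction with zero row and column sums, until the first entry becomes integral,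
    keeps all sums and all integral entries. *)
Lemma round_one_entry Z i0 j0 :
  (forall i, \sum_j Z i j \is a Num.int) -> (forall j, \sum_i Z i j \is a Num.int) ->
  nonint Z != set0 ->
  exists Z', [/\ (#|nonint Z'| < #|nonint Z|)%N, rounds_to Z Z',
    forall i, \sum_j Z' i j = \sum_j Z i j,
    forall j, \sum_i Z' i j = \sum_i Z i j & Z i0 j0 <= Z' i0 j0].
Proof.
move=> rowZ colZ Z0; have [x] := nonint_direction rowZ colZ Z0.
(* The sign of the direction is chosen so that the marked entry does not decrease. *)
wlog x0 : x / 0 <= x i0 j0.
  move=> IH xP; have [x0|/ltW x0] := leP 0 (x i0 j0); first exact: IH xP.
  case: xP => [[i [j xij]] xZ rowx colx].
  apply: (IH (fun i j => - x i j)); first by rewrite oppr_ge0.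
  split=> [|i' j' /xZ->|i'|j']; rewrite ?oppr0 ?sumrN ?rowx ?colx ?oppr0 //.
  by exists i, j; rewrite oppr_eq0.
case=> [[i [j xij]] xZ rowx colx].
pose fl i j : R := (Num.floor (Z i j))%:~R.
have fl_le i' j' : fl i' j' <= Z i' j' by exact: floor_le.
have lt_fl i' j' : Z i' j' < fl i' j' + 1 by rewrite /fl -(intrD _ _ 1) floorD1_gt.
have lt_fl2 i' j' : x i' j' != 0 -> fl i' j' < Z i' j'.
  move=> xn; rewrite lt_neqAle fl_le andbT; apply: contraNneq xn => e.
  by rewrite xZ // -e; apply: intr_int.
(* The time at which an entry moving with velocity [x] reaches the next integer; the least such time
   is the step length. *)
pose lam (f : I * J) :=
  ((if 0 < x f.1 f.2 then fl f.1 f.2 + 1 else fl f.1 f.2) - Z f.1 f.2) / x f.1 f.2.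
pose P (f : I * J) := x f.1 f.2 != 0.
have Pij : P (i, j) by [].
case: (arg_minP lam Pij) => -[i1 j1] Pf minf.
set l := lam (i1, j1) in minf.
have l_gt0 : 0 < l.
  rewrite /l /lam /=; case: (ltP 0 (x i1 j1)) => [xp|xn].
    by rewrite divr_gt0 // subr_gt0 lt_fl.
  have xlt : x i1 j1 < 0 by rewrite lt_neqAle xn andbT.
  by rewrite -mulrNN -invrN divr_gt0 ?oppr_gt0 // subr_lt0 lt_fl2.
pose Z' i j := Z i j + l * x i j.
have Z'int i' j' : Z i' j' \is a Num.int -> Z' i' j' = Z i' j'.
  by move=> Zi; rewrite /Z' xZ // mulr0 addr0.
have bounds i' j' : fl i' j' <= Z' i' j' <= fl i' j' + 1.
  have [x0'|xn0] := eqVneq (x i' j') 0.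
    by rewrite /Z' x0' mulr0 addr0 fl_le ltW // lt_fl.
  have := minf (i', j') xn0; rewrite /lam /=; case: (ltP 0 (x i' j')) => [xp|xn].
    rewrite ler_pdivlMr // => h; rewrite /Z'; have := fl_le i' j'.
    have := mulr_gt0 l_gt0 xp; lra.
  have xlt : x i' j' < 0 by rewrite lt_neqAle xn0.
  rewrite ler_ndivlMr // => h; rewrite /Z'; have := lt_fl i' j'.
  have : l * x i' j' < 0 by rewrite pmulr_rlt0.
  lra.
exists Z'; split.
- apply: proper_card; apply/properP; split.
    apply/subsetP => -[i' j']; rewrite !inE /=; apply: contra => Zi.
    by rewrite Z'int.
  exists (i1, j1); rewrite !inE /=.
    by apply: contra Pf => /xZ /= ->.
  rewrite negbK /Z' /l /lam /= divfK ?[_ == 0](negbTE Pf) // addrC subrK; case: ifP => _.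
    by apply: rpredD; rewrite ?rpred1 // intr_int.
  exact: intr_int.
- move=> i' j' k; case/andP: (bounds i' j') => lo hi; split=> hk.
    apply: le_trans lo; by rewrite /fl ler_int floor_ge_int.
  have [Zi|Zi] := boolP (Z i' j' \is a Num.int); first by rewrite Z'int.
  apply: le_trans hi _; rewrite /fl -(intrD _ _ 1) ler_int lezD1.
  rewrite -(ltr_int R); apply: lt_le_trans hk.
  rewrite lt_neqAle fl_le andbT; apply: contraNneq Zi => <-; exact: intr_int.
- by move=> i'; rewrite big_split /= -mulr_sumr rowx mulr0 addr0.
- by move=> j'; rewrite big_split /= -mulr_sumr colx mulr0 addr0.
- by rewrite /Z' lerDl mulr_ge0 // ltW.
Qed.

Lemma matrix_rounding Z i0 j0 :
  (forall i, \sum_j Z i j \is a Num.int) -> (forall j, \sum_i Z i j \is a Num.int) ->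
  exists Z', [/\ forall i j, Z' i j \is a Num.int, rounds_to Z Z',
    forall i, \sum_j Z' i j = \sum_j Z i j,
    forall j, \sum_i Z' i j = \sum_i Z i j & Z i0 j0 <= Z' i0 j0].
Proof.
have [n] := ubnP #|nonint Z|; elim: n Z => // n IHn Z; rewrite ltnS => leZ rowZ colZ.
have [Z0|Zn0] := eqVneq (nonint Z) set0.
  exists Z; split=> // i j; have /setP/(_ (i, j)) := Z0.
  by rewrite !inE => /negbFE.
have [Z1 [ltZ1 Z1r row1 col1 le1]] := round_one_entry i0 j0 rowZ colZ Zn0.
have [||| Z2 [int2 Z2r row2 col2 le2]] := IHn Z1.
- exact: leq_trans ltZ1 leZ.
- by move=> i; rewrite row1.
- by move=> j; rewrite col1.
exists Z2; split=> //.
- move=> i j k; have [a1 b1] := Z1r i j k; have [a2 b2] := Z2r i j k.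
  by split=> [/a1/a2|/b1/b2].
- by move=> i; rewrite row2 row1.
- by move=> j; rewrite col2 col1.
- exact: le_trans le1 le2.
Qed.
End Rounding.

(** * Random thinning *)

Section RandomSubset.
Variables (R : realFieldType) (V : finType) (x : V -> R).
Implicit Types (S : {set V}) (f : {set V} -> R).

(** The random set [S] contains each [v] independently with probability [x v]. *)
Definition prob S := \prod_v (if v \in S then x v else 1 - x v).
Definition mean f := \sum_S prob S * f S.

(** Independence of the memberships; the moments below are derived from it. *)
Lemma mean_prod (g : V -> bool -> R) :
  mean (fun S => \prod_v g v (v \in S)) =
  \prod_v (x v * g v true + (1 - x v) * g v false).
Proof.
rewrite bigA_distr; apply: eq_bigr => S _; rewrite /prob -big_split /=.
by apply: eq_bigr => v _; case: ifP.
Qed.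

Lemma mean1 : mean (fun=> 1) = 1.
Proof.
have H := mean_prod (fun _ _ => 1).
transitivity (mean (fun=> \prod_(v : V) 1)).
  by apply: eq_bigr => S _; rewrite big1.
rewrite H; by apply: big1 => v _; rewrite !mulr1 addrC subrK.
Qed.

Lemma eq_mean f g : f =1 g -> mean f = mean g.
Proof. by move=> fg; apply: eq_bigr => S _; rewrite fg. Qed.

Lemma meanD f g : mean (fun S => f S + g S) = mean f + mean g.
Proof. by rewrite -big_split; apply: eq_bigr => S _; rewrite mulrDr. Qed.

Lemma meanZ a f : mean (fun S => a * f S) = a * mean f.
Proof. by rewrite [RHS]mulr_sumr; apply: eq_bigr => S _; rewrite mulrCA. Qed.

Lemma mean_sum (I : finType) (P : pred I) (f : I -> {set V} -> R) :
  mean (fun S => \sum_(i | P i) f i S) = \sum_(i | P i) mean (f i).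
Proof. by rewrite exchange_big; apply: eq_bigr => S _; rewrite mulr_sumr. Qed.

Lemma mean_in v : mean (fun S => (v \in S)%:R) = x v.
Proof.
have := mean_prod (fun w b => if w == v then b%:R else 1).
rewrite (bigD1 v) //= eqxx mulr1 mulr0 addr0 big1 ?mulr1; last first.
  by move=> w /negbTE ->; rewrite !mulr1 addrC subrK.
move=> <-; apply: eq_mean => S.
by rewrite (bigD1 v) //= eqxx big1 ?mulr1 // => w /negbTE ->.
Qed.

Lemma prod_eq1 (u : V) (a : R) : \prod_w (if w == u then a else 1) = a.
Proof. by rewrite (bigD1 u) //= eqxx big1 ?mulr1 // => w /negbTE ->. Qed.

Lemma mean_cov v u u' : u != v -> u' != v ->
  mean (fun S => (v \in S)%:R * (((u \in S)%:R - x u) * ((u' \in S)%:R - x u'))) =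
  (u == u')%:R * (x v * (x u * (1 - x u))).
Proof.
move=> uv u'v.
pose g w (b : bool) : R := (if w == v then b%:R else 1) *
  ((if w == u then b%:R - x u else 1) * (if w == u' then b%:R - x u' else 1)).
transitivity (mean (fun S => \prod_w g w (w \in S))).
  apply: eq_mean => S; rewrite /g !big_split /=.
  congr (_ * (_ * _)).
  - by rewrite -[LHS](prod_eq1 v); apply: eq_bigr => w _; case: eqP => // ->.
  - by rewrite -[LHS](prod_eq1 u); apply: eq_bigr => w _; case: eqP => // ->.
  - by rewrite -[LHS](prod_eq1 u'); apply: eq_bigr => w _; case: eqP => // ->.
rewrite mean_prod /g; have [<-|uu'] := eqVneq u u'; last first.
  rewrite mul0r (bigD1 u) //= (negbTE uv) eqxx (negbTE uu') !mulr1 !mul1r.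
  by rewrite [X in X * _](_ : _ = 0) ?mul0r //; ring.
rewrite mul1r (bigD1 v) //= eqxx (eq_sym v) (negbTE uv) !mulr1 mulr0 addr0.
congr (_ * _); rewrite (bigD1 u) ?uv //= (negbTE uv) eqxx.
rewrite big1 ?mulr1; last first.
  by move=> w /andP[/negbTE -> /negbTE ->]; rewrite !mulr1 addrC subrK.
by ring.
Qed.

(** Since [a v = 0], the sum is independent of the membership of [v], and the cross terms of the
    square have mean zero. *)
Lemma mean_sqr v (a : V -> R) : a v = 0 ->
  mean (fun S => (v \in S)%:R * (\sum_u a u * ((u \in S)%:R - x u)) ^+ 2) =
  x v * \sum_u a u ^+ 2 * (x u * (1 - x u)).
Proof.
move=> av.
transitivity (\sum_u \sum_u' a u * a u' *
    mean (fun S => (v \in S)%:R * (((u \in S)%:R - x u) * ((u' \in S)%:R - x u')))).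
  transitivity (mean (fun S => \sum_u \sum_u' a u * a u' * ((v \in S)%:R *
      (((u \in S)%:R - x u) * ((u' \in S)%:R - x u'))))); last first.
    rewrite mean_sum; apply: eq_bigr => u _; rewrite mean_sum; apply: eq_bigr => u' _.
    by rewrite meanZ.
  apply: eq_mean => S; rewrite expr2 mulr_suml mulr_sumr; apply: eq_bigr => u _.
  by rewrite !mulr_sumr; apply: eq_bigr => u' _; ring.
rewrite mulr_sumr; apply: eq_bigr => u _.
have [->|uv] := eqVneq u v.
  by rewrite av expr0n mul0r mulr0 big1 // => u' _; rewrite !mul0r.
rewrite (bigD1 u) //= mean_cov // eqxx big1 ?addr0; last first.
  move=> u' u'u; have [->|u'v] := eqVneq u' v; first by rewrite av mulr0 mul0r.
  by rewrite mean_cov // eq_sym (negbTE u'u) mul0r mulr0.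
by rewrite mul1r; ring.
Qed.

Lemma mean_lt f c : (forall v, 0 <= x v <= 1) -> mean f < c -> exists S, f S < c.
Proof.
move=> x01 lt; apply/existsP; apply: contraLR lt => /existsPn ge.
rewrite -leNgt -[c]mulr1 -mean1 -meanZ; apply: ler_sum => S _.
apply: ler_wpM2l; last by rewrite mulr1 leNgt.
apply: prodr_ge0 => v _; case/andP: (x01 v) => x0 x1.
by case: ifP; rewrite ?subr_ge0.
Qed.
End RandomSubset.

(** Jensen's inequality for weights of total at most 1, from the nonnegative second moment about
    [m]. *)
Lemma sqr_sum_le (R : realFieldType) (I : finType) (p b : I -> R) :
  (forall i, 0 <= p i) -> \sum_i p i <= 1 ->
  (\sum_i p i * b i) ^+ 2 <= \sum_i p i * b i ^+ 2.
Proof.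
move=> p0 p1; set m := \sum_i p i * b i.
have : 0 <= \sum_i p i * (b i - m) ^+ 2.
  by apply: sumr_ge0 => i _; rewrite mulr_ge0 // sqr_ge0.
have -> : \sum_i p i * (b i - m) ^+ 2 =
    \sum_i p i * b i ^+ 2 - 2 * m * m + m ^+ 2 * \sum_i p i.
  transitivity (\sum_i (p i * b i ^+ 2 + (- (2 * m)) * (p i * b i) + m ^+ 2 * p i)).
    by apply: eq_bigr => i _; ring.
  by rewrite !big_split /= -!mulr_sumr -/m mulNr.
have := ler_wpM2l (sqr_ge0 m) p1; lra.
Qed.

(** * Weightings with degrees at most 1, and truncation *)

Section Weights.
Variables (R : realFieldType) (V : finType).
Implicit Types (w : V -> V -> R) (X : {set V}) (c : R).

Definition wdeg w v := \sum_u w v u.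
Definition deficit w v := 1 - wdeg w v.

(** [X] contains the support and [c] caps the weights. Vertices outside [X] have deficit 1, so
    deficits are summed over [X] only. *)
Definition weighting w X c := [/\ forall u v, w u v = w v u,
  forall u v, 0 <= w u v <= c, forall v, w v v = 0,
  forall u v, v \notin X -> w u v = 0 & forall v, wdeg w v <= 1].

(** Each weight is multiplied by [M u * M v], where [M v] brings a degree above 1 down to 1. A
    vertex loses a further [l v] through its neighbours; double counting bounds the total of these
    losses by the total overshoot. *)
Lemma truncation W X c :
  (forall u v, W u v = W v u) -> (forall u v, 0 <= W u v <= c) ->
  (forall v, W v v = 0) -> (forall u v, v \notin X -> W u v = 0) ->
  exists w l, [/\ weighting w X c, forall u v, W u v = 0 -> w u v = 0,
    forall v, 0 <= l v /\ deficit w v = Num.max (1 - wdeg W v) 0 + l v,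
    \sum_(v in X) l v <= \sum_(v in X) Num.max (wdeg W v - 1) 0 &
    \sum_(v in X) l v ^+ 2 <= \sum_(v in X) Num.max (wdeg W v - 1) 0 ^+ 2].
Proof.
move=> Wsym W0 Wvv WX.
pose y := wdeg W; pose M v := if y v <= 1 then 1 else (y v)^-1.
have y0 v : 0 <= y v by apply: sumr_ge0 => u _; case/andP: (W0 v u).
have M01 v : 0 <= M v <= 1.
  rewrite /M; case: (leP (y v) 1) => [|y1]; first by rewrite ler01 lexx.
  by rewrite invr_ge0 y0 invf_le1 ?(lt_trans ltr01) // ltW.
have My v : 1 - M v * y v = Num.max (1 - y v) 0.
  rewrite /M; case: (leP (y v) 1) => y1; first by rewrite mul1r max_l // subr_ge0.
  by rewrite mulVf ?subrr ?max_r ?subr_le0 ?(ltW y1) // gt_eqF // (lt_trans ltr01).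
have yM v : y v * (1 - M v) = Num.max (y v - 1) 0.
  rewrite /M; case: (leP (y v) 1) => y1; first by rewrite subrr mulr0 max_r // subr_le0.
  by rewrite mulrBr mulfV ?mulr1 ?max_l ?subr_ge0 ?(ltW y1) // gt_eqF // (lt_trans ltr01).
have M1 v : 1 - M v <= Num.max (y v - 1) 0.
  rewrite -yM; rewrite /M; case: (leP (y v) 1) => y1; first by rewrite subrr mulr0.
  by apply: ler_peMl (ltW y1); rewrite subr_ge0 invf_le1 ?(lt_trans ltr01) // ltW.
pose l v := \sum_u W v u * M v * (1 - M u).
have p0 v u : 0 <= W v u * M v by case/andP: (W0 v u) => ? _; case/andP: (M01 v) => ? _; apply: mulr_ge0.
have q0 u : 0 <= 1 - M u by case/andP: (M01 u) => _; rewrite subr_ge0.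
have l0 v : 0 <= l v by apply: sumr_ge0 => u _; apply: mulr_ge0.
pose w u v := W u v * M u * M v.
have w0 u v : 0 <= w u v by apply: mulr_ge0 => //; case/andP: (M01 v).
have wdegE v : wdeg w v = M v * y v - l v.
  rewrite /l /y /wdeg mulr_sumr -sumrN -big_split /=; apply: eq_bigr => u _.
  by rewrite /w; ring.
have Myle v : M v * y v <= 1.
  rewrite -subr_ge0 My le_max lexx orbT //.
have sumW (b : V -> R) : \sum_v \sum_u W v u * b u = \sum_u y u * b u.
  rewrite exchange_big; apply: eq_bigr => u _; rewrite /y /wdeg mulr_suml.
  by apply: eq_bigr => v _; rewrite Wsym.
have y_out v : v \notin X -> y v = 0.
  by move=> vX; apply: big1 => u _; rewrite Wsym WX.
have sumX (b : V -> R) : (forall v, 0 <= b v) -> \sum_(v in X) b v <= \sum_v b v.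
  move=> b0; rewrite [leRHS](bigID (mem X)) /= lerDl; exact: sumr_ge0.
exists w, l; split.
- split.
  + by move=> u v; rewrite /w Wsym; ring.
  + move=> u v; rewrite w0 /=; case/andP: (W0 u v) => W0' Wc.
    apply: le_trans Wc; rewrite /w -mulrA -[leRHS]mulr1.
    apply: ler_wpM2l => //; case/andP: (M01 u) => ? ?; case/andP: (M01 v) => ? ?.
    exact: mulr_ile1.
  + by move=> v; rewrite /w Wvv !mul0r.
  + by move=> u v vX; rewrite /w WX // !mul0r.
  + move=> v; rewrite wdegE; have := l0 v; have := Myle v; lra.
- by move=> u v Wuv; rewrite /w Wuv !mul0r.
- by move=> v; split=> //; rewrite /deficit wdegE -My; ring.
- apply: (le_trans (sumX _ l0)).
  apply: (@le_trans _ _ (\sum_v \sum_u W v u * (1 - M u))).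
    apply: ler_sum => v _; apply: ler_sum => u _; apply: ler_wpM2r => //.
    case/andP: (W0 v u) => ? _; case/andP: (M01 v) => _ ?.
    by rewrite -[leRHS]mulr1 ler_wpM2l.
  rewrite sumW (bigID (mem X)) /= [X in _ + X]big1 ?addr0.
    by apply: ler_sum => v _; rewrite yM.
  by move=> v vX; rewrite y_out ?mul0r.
(* The coefficients [W v u * M v] sum to at most 1 over [u], so Jensen applies to [l v]. Exchanging
   the sums leaves [y u * (1 - M u) ^+ 2], where [y u * (1 - M u)] is the overshoot and dominates
   [1 - M u]. *)
- apply: (le_trans (sumX _ (fun v => sqr_ge0 (l v)))).
  apply: (@le_trans _ _ (\sum_v \sum_u W v u * (1 - M u) ^+ 2)).
    apply: ler_sum => v _.
    apply: (@le_trans _ _ (\sum_u W v u * M v * (1 - M u) ^+ 2)).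
      apply: sqr_sum_le; first by [].
      by rewrite -mulr_suml mulrC; apply: Myle.
    apply: ler_sum => u _; apply: ler_wpM2r; first exact: sqr_ge0.
    case/andP: (W0 v u) => ? _; case/andP: (M01 v) => _ ?.
    by rewrite -[leRHS]mulr1 ler_wpM2l.
  rewrite sumW (bigID (mem X)) /= [X in _ + X]big1 ?addr0.
    apply: ler_sum => v _; rewrite expr2 mulrA yM expr2.
    apply: ler_wpM2l (M1 v); by rewrite le_max lexx orbT.
  by move=> v vX; rewrite y_out ?mul0r.
Qed.
End Weights.

(** The expected shortfall of the rescaled degree when the deletion probability is the deficit
    capped at [delta]: it is 0 for deficits up to [delta]. *)
Definition excess (R : realFieldType) (V : finType) (w : V -> V -> R) delta v :=
  Num.max (deficit w v - delta) 0 / (1 - delta).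

Section Thinning.
Variables (R : realFieldType) (V : finType).
Variables (w : V -> V -> R) (X : {set V}) (c delta : R).
Hypotheses (wX : weighting w X c) (delta01 : 0 < delta < 1).

(* [x v] is the survival probability of [v], and [xi S v] the deviation of the rescaled
   weighted degree of [v] from its mean [1 - rho v]. *)
Let c' : R := c / (1 - delta) ^+ 2.
Let s v : R := deficit w v.
Let rho v : R := excess w delta v.
Let x v : R := 1 - Num.min (s v) delta.
Let xi (S : {set V}) v : R := (x v)^-1 * \sum_u w v u / x u * ((u \in S)%:R - x u).
Let Xi (S : {set V}) : R := \sum_(v in X) (v \in S)%:R * xi S v ^+ 2.

Let delta_lt1 : 0 < 1 - delta. Proof. by rewrite subr_gt0; case/andP: delta01. Qed.
Let s_ge0 v : 0 <= s v. Proof. by rewrite subr_ge0; case: wX. Qed.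

Let x_ge v : 1 - delta <= x v.
Proof. by rewrite lerD2l lerN2 ge_min lexx orbT. Qed.

Let x_gt0 v : 0 < x v. Proof. exact: lt_le_trans (x_ge v). Qed.

Let x_le1 v : x v <= 1.
Proof. by rewrite gerBl le_min s_ge0 ltW //; case/andP: delta01. Qed.

Let wle u v : w u v / x u / x v <= c'.
Proof.
case: wX => _ w0c _ _ _; case/andP: (w0c u v) => w0 wc.
rewrite -mulrA -invfM /c'; apply: ler_pM => //.
  by rewrite invr_ge0 mulr_ge0 // ltW.
rewrite lef_pV2 ?posrE ?mulr_gt0 ?exprn_gt0 // expr2.
by apply: ler_pM; rewrite ?x_ge ?ltW.
Qed.

Let c'_ge0 : X != set0 -> 0 <= c'.
Proof.
case/set0Pn => v _; case: wX => _ /(_ v v) /andP[w0 wc] _ _ _.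
by apply: divr_ge0; [exact: le_trans wc | rewrite exprn_ge0 ?(ltW delta_lt1)].
Qed.

(** By [mean_sqr] the mean is a sum of [w v u ^+ 2 / x v / x u * (1 - x u)]. One factor is absorbed
    by the cap [c'], the sum over [v] of the other is at most 1, and [1 - x u] is at most the
    deficit. *)
Let mean_Xi : mean x Xi <= c' * \sum_(v in X) s v.
Proof.
case: wX => wsym w0c wvv wXv wd1.
have w0 u v : 0 <= w u v by case/andP: (w0c u v).
have -> : mean x Xi = \sum_(v in X) \sum_u w v u ^+ 2 / x v / x u * (1 - x u).
  rewrite /Xi mean_sum; apply: eq_bigr => v vX.
  transitivity ((x v)^-1 ^+ 2 * mean x (fun S => (v \in S)%:R *
      (\sum_u w v u / x u * ((u \in S)%:R - x u)) ^+ 2)).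
    by rewrite -meanZ; apply: eq_mean => S; rewrite /xi exprMn; ring.
  rewrite mean_sqr ?wvv ?mul0r // mulrA mulr_sumr; apply: eq_bigr => u _.
  by field; rewrite !gt_eqF.
have le1 v u : w v u ^+ 2 / x v / x u * (1 - x u) <= c' * (1 - x u) * w v u.
  have -> : w v u ^+ 2 / x v / x u * (1 - x u) = w v u / x v / x u * ((1 - x u) * w v u).
    by ring.
  by rewrite -[leRHS]mulrA; apply: ler_wpM2r; rewrite ?wle // mulr_ge0 ?subr_ge0.
apply: (@le_trans _ _ (\sum_v \sum_u c' * (1 - x u) * w v u)).
  rewrite [leRHS](bigID (mem X)) /= -[leLHS]addr0; apply: lerD.
    by apply: ler_sum => v _; apply: ler_sum.
  rewrite big1 // => v vX; rewrite big1 // => u _.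
  by rewrite wsym wXv // mulr0.
rewrite exchange_big /= (bigID (mem X)) /= [X in _ + X]big1 ?addr0; last first.
  by move=> u uX; rewrite big1 // => v _; rewrite wXv // mulr0.
have [->|X0] := eqVneq X set0; first by rewrite !big_set0 mulr0.
rewrite mulr_sumr; apply: ler_sum => u _.
rewrite -mulr_sumr -mulrA; apply: ler_wpM2l; first exact: c'_ge0.
rewrite opprB addrC subrK (eq_bigr (w u)) //.
apply: (@le_trans _ _ (s u * 1)); last by rewrite mulr1.
apply: ler_pM.
- by rewrite le_min s_ge0 ltW //; case/andP: delta01.
- by apply: sumr_ge0.
- by rewrite ge_min lexx.
- exact: wd1.
Qed.

(** The thresholds are three times the bounds on the means, so the two normalised quantities have
    total mean below 1 and one set meets both bounds. *)
Let exists_survivors tau : X != set0 -> 0 < c -> 0 < tau ->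
  \sum_(v in X) s v <= tau * #|X|%:R ->
  exists S, #|X :\: S|%:R < 3 * tau * #|X|%:R /\ Xi S < 3 * c' * tau * #|X|%:R.
Proof.
move=> X0 c0 tau0 sX.
have N0 : 0 < #|X|%:R :> R by rewrite ltr0n card_gt0.
have c'0 : 0 < c' by rewrite /c' divr_gt0 ?exprn_gt0.
have p1 : 0 < 3 * tau * #|X|%:R by rewrite !mulr_gt0.
have p2 : 0 < 3 * c' * tau * #|X|%:R.
  by rewrite (mulr_gt0 _ N0) // (mulr_gt0 _ tau0) // mulr_gt0.
pose a := (3 * tau * #|X|%:R)^-1; pose b := (3 * c' * tau * #|X|%:R)^-1.
have a0 : 0 < a by rewrite invr_gt0.
have b0 : 0 < b by rewrite invr_gt0.
pose K S : R := #|X :\: S|%:R.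
have KE S : K S = \sum_(v in X) (1 - (v \in S)%:R).
  rewrite /K -sum1_card natr_sum big_mkcond [RHS]big_mkcond /=.
  by apply: eq_bigr => v _; rewrite inE; case: (v \in S); case: (v \in X); rewrite /= ?subrr ?subr0.
have mK : mean x K = \sum_(v in X) (1 - x v).
  rewrite (eq_mean _ KE) mean_sum; apply: eq_bigr => v _.
  transitivity (mean x (fun S => 1 + (-1) * (v \in S)%:R)).
    by apply: eq_mean => S; rewrite mulN1r.
  by rewrite meanD meanZ mean1 mean_in mulN1r.
have [S] : exists S, a * K S + b * Xi S < 1.
  apply: (mean_lt (x := x)); first by move=> v; rewrite x_le1 ltW.
  rewrite meanD !meanZ mK.
  have h1 : a * \sum_(v in X) (1 - x v) <= 1 / 3.
    rewrite mulrC ler_pdivrMr //.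
    apply: (@le_trans _ _ (\sum_(v in X) s v)); last by apply: (le_trans sX); lra.
    by apply: ler_sum => v _; rewrite opprB addrC subrK ge_min lexx.
  have h2 : b * mean x Xi <= 1 / 3.
    rewrite mulrC ler_pdivrMr //; apply: (le_trans mean_Xi).
    have := ler_wpM2l (ltW c'0) sX; lra.
  lra.
move=> hS; exists S.
have K0 : 0 <= K S by [].
have Xi0 : 0 <= Xi S by apply: sumr_ge0 => v _; rewrite mulr_ge0 ?sqr_ge0.
split.
  have : a * K S < 1 by have := mulr_ge0 (ltW b0) Xi0; lra.
  by rewrite mulrC ltr_pdivrMr ?mul1r.
have : b * Xi S < 1 by have := mulr_ge0 (ltW a0) K0; lra.
by rewrite mulrC ltr_pdivrMr ?mul1r.
Qed.

(** Weights between survivors are divided by both survival probabilities, then truncated. The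
    parameters [eta] and [theta] are left free to balance the excess against the fluctuations
    [xi]. *)
Lemma thinning tau : X != set0 -> 0 < c -> 0 < tau ->
  \sum_(v in X) deficit w v <= tau * #|X|%:R ->
  exists X' w', [/\ weighting w' X' (c / (1 - delta) ^+ 2) /\ (forall u v, w u v = 0 -> w' u v = 0),
    X' \subset X, (1 - 3 * tau) * #|X|%:R < #|X'|%:R,
    forall eta, 0 < eta -> \sum_(v in X') deficit w' v <=
      \sum_(v in X) excess w delta v + eta * #|X'|%:R + 3 * (c / (1 - delta) ^+ 2) * tau * #|X|%:R / (4 * eta) &
    forall theta, 0 < theta -> \sum_(v in X') deficit w' v ^+ 2 <=
      (1 + theta) * \sum_(v in X) excess w delta v ^+ 2 +
      (1 + theta^-1) * (6 * (c / (1 - delta) ^+ 2) * tau * #|X|%:R)].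
Proof.
move=> X0 c0 tau0 sX; have [S [killS XiS]] := exists_survivors X0 c0 tau0 sX.
case: wX => wsym w0c wvv wXv wd1.
have w0 u v : 0 <= w u v by case/andP: (w0c u v).
pose X' := X :&: S.
pose W u v := if (u \in S) && (v \in S) then w u v / x u / x v else 0.
have Wsym u v : W u v = W v u by rewrite /W andbC wsym mulrAC.
have W0c u v : 0 <= W u v <= c'.
  rewrite /W; case: ifP => _; last by rewrite lexx c'_ge0.
  by rewrite wle !divr_ge0 // ltW.
have Wvv v : W v v = 0 by rewrite /W wvv !mul0r if_same.
have WX u v : v \notin X' -> W u v = 0.
  rewrite inE negb_and /W => /orP[/wXv->|/negbTE->]; last by rewrite andbF.
  by rewrite !mul0r if_same.
have [w' [l [w'X' w'W w'def suml suml2]]] := truncation Wsym W0c Wvv WX.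
have rho0 v : 0 <= rho v by rewrite divr_ge0 ?le_max ?lexx ?orbT // ltW.
have WE v : v \in X' -> wdeg W v = 1 - rho v + xi S v.
  rewrite inE => /andP[vX vS].
  have -> : 1 - rho v = wdeg w v / x v.
    have -> : wdeg w v = 1 - s v by rewrite /s /deficit; ring.
    apply: (mulIf (lt0r_neq0 (x_gt0 v))); rewrite divfK ?gt_eqF //.
    rewrite /rho /excess /x -/(s v); case: (leP (s v) delta) => h.
      by rewrite max_r ?subr_le0 // mul0r subr0 mul1r.
    by rewrite max_l ?subr_ge0 ?ltW // mulrBl divfK ?gt_eqF //; ring.
  rewrite /xi /wdeg mulr_suml mulr_sumr -big_split /=; apply: eq_bigr => u _.
  rewrite /W vS /=; by case: (u \in S) => /=; field; rewrite !lt0r_neq0.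
have XiE : \sum_(v in X') xi S v ^+ 2 = Xi S.
  rewrite /Xi big_mkcond [RHS]big_mkcond; apply: eq_bigr => v _.
  by rewrite inE; case: (v \in X); case: (v \in S) => //=; rewrite ?mul1r ?mul0r.
have sub_sum (f : V -> R) : (forall v, 0 <= f v) -> \sum_(v in X') f v <= \sum_(v in X) f v.
  move=> f0; rewrite [leRHS](big_setID S) /= lerDl; exact: sumr_ge0.
exists X', w'; split.
- by split=> // u v wuv; apply: w'W; rewrite /W wuv !mul0r if_same.
- exact: subsetIl.
- have : #|X|%:R = #|X'|%:R + #|X :\: S|%:R :> R by rewrite -natrD cardsID.
  lra.
- move=> eta eta0.
  apply: (@le_trans _ _ (\sum_(v in X') (rho v + eta + xi S v ^+ 2 / (4 * eta)))).
    under eq_bigr => v _ do rewrite (w'def v).2.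
    rewrite big_split /=; apply: (le_trans (lerD (lexx _) suml)).
    rewrite -big_split /=; apply: ler_sum => v vX'; rewrite WE //.
    apply: (@le_trans _ _ (rho v + `|xi S v|)).
      have := rho0 v; have := ler_norm (xi S v); have := ler_norm (- xi S v).
      rewrite normrN; set z := xi S v; set n := `|z|.
      case: (leP (1 - (1 - rho v + z)) 0) => h1; case: (leP (1 - rho v + z - 1) 0) => h2; lra.
    rewrite -addrA lerD2l -(real_normK (num_real (xi S v))); set n := `|_|.
    have -> : eta + n ^+ 2 / (4 * eta) = n + (n - 2 * eta) ^+ 2 / (4 * eta).
      by field; rewrite gt_eqF.
    by rewrite lerDl divr_ge0 ?sqr_ge0 // mulr_ge0 // ltW.
  rewrite !big_split /= sumr_const -[X in _ + X <= _]mulr_suml XiE -[eta *+ _]mulr_natr.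
  apply: lerD; first by rewrite lerD2r sub_sum.
  by apply: ler_wpM2r; rewrite ?invr_ge0 ?mulr_ge0 // ltW.
- move=> theta theta0.
  (* [b v] bounds the new deficit beyond [rho v]. Its first term is the negative part of [xi S v],
     and the squares of [l] are paid for by the positive parts. *)
  pose b v := Num.max (- xi S v) 0 + l v.
  have b2 : \sum_(v in X') b v ^+ 2 <= 2 * Xi S.
    apply: (@le_trans _ _ (2 * (\sum_(v in X') Num.max (- xi S v) 0 ^+ 2 + \sum_(v in X') l v ^+ 2))).
      rewrite -big_split mulr_sumr /=; apply: ler_sum => v _; rewrite /b.
      set p := Num.max _ _; set q := l v.
      have := sqr_ge0 (p - q); lra.
    rewrite ler_pM2l // -XiE; apply: (le_trans (lerD (lexx _) suml2)).
    rewrite -big_split /=; apply: ler_sum => v vX'; rewrite WE //.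
    set z := xi S v; have r0 := rho0 v.
    case: (leP (- z) 0) => h1; case: (leP (1 - rho v + z - 1) 0) => h2;
      rewrite ?expr0n /= ?add0r ?addr0 ?sqrrN ?sqr_ge0 //.
      by rewrite ler_sqr ?nnegrE; lra.
    lra.
  apply: (@le_trans _ _ (\sum_(v in X') ((1 + theta) * rho v ^+ 2 + (1 + theta^-1) * b v ^+ 2))).
    apply: ler_sum => v vX'.
    apply: (@le_trans _ _ ((rho v + b v) ^+ 2)).
      rewrite (w'def v).2 WE // /b ler_sqr ?nnegrE.
      - rewrite addrA lerD2r; have := rho0 v; set z := xi S v => r0.
        by case: (leP (1 - (1 - rho v + z)) 0) => h1; case: (leP (- z) 0) => h2; lra.
      - by rewrite addr_ge0 ?(w'def v).1 // le_max lexx orbT.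
      - by rewrite !addr_ge0 ?(w'def v).1 // le_max lexx orbT.
    set p := rho v; set q := b v.
    have -> : (1 + theta) * p ^+ 2 + (1 + theta^-1) * q ^+ 2 =
        (p + q) ^+ 2 + (theta * p - q) ^+ 2 / theta by field; rewrite gt_eqF.
    by rewrite lerDl divr_ge0 ?sqr_ge0 // ltW.
  rewrite big_split /= -!mulr_sumr; apply: lerD.
    apply: ler_wpM2l; first by rewrite addr_ge0 // ltW.
    by apply: sub_sum => v; apply: sqr_ge0.
  apply: ler_wpM2l; first by rewrite addr_ge0 // invr_ge0 ltW.
  by apply: (le_trans b2); rewrite -/c'; lra.
Qed.
End Thinning.

(** * Iterated thinning *)

Section Regularisation.
Variables (R : archiRealFieldType) (V : finType).
Implicit Types (w : V -> V -> R) (X : {set V}).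

Definition supported_by w w' := forall u v, w u v = 0 -> w' u v = 0.

Lemma supported_trans w1 w2 w3 : supported_by w1 w2 -> supported_by w2 w3 ->
  supported_by w1 w3.
Proof. by move=> h12 h23 u v /h12/h23. Qed.

Lemma weightingW w X c1 c2 : c1 <= c2 -> weighting w X c1 -> weighting w X c2.
Proof.
move=> c12 [? w0c ? ? ?]; split=> // u v; case/andP: (w0c u v) => -> /=.
by move/le_trans; apply.
Qed.

Lemma deficit_bounds w X c v : weighting w X c -> 0 <= deficit w v <= 1.
Proof.
case=> _ w0 _ _ w1; rewrite subr_ge0 w1 /= gerBl.
by apply: sumr_ge0 => u _; case/andP: (w0 v u).
Qed.

Lemma excess_ge0 w delta v : delta < 1 -> 0 <= excess w delta v.
Proof.
by move=> d1; apply: divr_ge0; [rewrite le_max lexx orbT | rewrite subr_ge0 ltW].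
Qed.

Lemma excess_le w X c delta v : weighting w X c -> 0 < delta < 1 ->
  excess w delta v <= deficit w v.
Proof.
move=> wX /andP[d0 d1]; have /andP[s0 s1] := deficit_bounds v wX.
rewrite ler_pdivrMr ?subr_gt0 // ge_max; apply/andP; split.
  by have := ler_wpM2r (ltW d0) s1; lra.
by rewrite mulr_ge0 // subr_ge0 ltW.
Qed.

(** This lets the second moment of the deficits control the part of them above [delta]. *)
Lemma excess_le_sqr w delta v : 0 < delta < 1 ->
  excess w delta v <= deficit w v ^+ 2 / (4 * delta) / (1 - delta).
Proof.
move=> /andP[d0 d1]; rewrite ler_pM2r ?invr_gt0 ?subr_gt0 // ge_max.
apply/andP; split; last by rewrite divr_ge0 ?sqr_ge0 // mulr_ge0 // ltW.
rewrite ler_pdivlMr ?mulr_gt0 //.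
have := sqr_ge0 (deficit w v - 2 * delta); lra.
Qed.

(* [u ^+ 2] bounds the average deficit; the cap and the second moment bound grow with
   each halving of [u] but stay below [cb] and [3 * cb]. *)
Definition stage w X cb u := [/\ X != set0,
  weighting w X (cb / 2 * (1 + 32 * cb / u ^+ 2)),
  \sum_(v in X) deficit w v <= u ^+ 2 * #|X|%:R &
  \sum_(v in X) deficit w v ^+ 2 <= 3 * cb * (1 - 8 * u) * #|X|%:R].

(** One round of thinning divides the bound [u ^+ 2] on the average deficit by 4. *)
Lemma stage_step w X cb u : 0 < cb -> 0 < u <= 1 / 16 -> 128 * cb <= u ^+ 2 ->
  stage w X cb u -> exists w' X', stage w' X' cb (u / 2) /\ supported_by w w'.
Proof.
move=> cb0 /andP[u0 u16] cbu [X0 wX S1 S2].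
have u20 : 0 < u ^+ 2 by rewrite exprn_gt0.
pose y := 32 * cb / u ^+ 2.
have y0 : 0 < y by rewrite divr_gt0 // mulr_gt0.
have yle : 4 * y <= 1 by rewrite /y mulrA ler_pdivrMr //; lra.
have yE : y * u ^+ 2 = 32 * cb by rewrite /y divfK // gt_eqF.
have y'E : 32 * cb / (u / 2) ^+ 2 = 4 * y by rewrite /y; field; rewrite gt_eqF.
rewrite -/y in wX; move: y y0 yle yE y'E wX => y y0 yle yE y'E wX.
(* [delta] is large enough for the second moment to bound the average excess by 3/56 of [u ^+ 2],
   and small enough that the factor [1 + y] in the cap grows to at most [1 + 4 * y], its value for
   [u / 2]. *)
pose delta := y / 2.
have d01 : 0 < delta < 1 by rewrite /delta; lra.
have d0 : 0 < delta by case/andP: d01.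
have d1' : 7 / 8 <= 1 - delta by rewrite /delta; lra.
have d1 : 0 < 1 - delta by case/andP: d01 => _; rewrite subr_gt0.
set c := cb / 2 * _ in wX.
have c0 : 0 < c by rewrite /c mulr_gt0 ?divr_gt0 // addr_gt0.
have [X' [w' [[w'X' w'w] X'X N' H1 H2]]] := thinning wX d01 X0 c0 u20 S1.
set c' := c / (1 - delta) ^+ 2 in w'X' H1 H2.
have c'le : c' <= cb / 2 * (1 + 4 * y).
  rewrite /c' /c ler_pdivrMr ?exprn_gt0 // -[leRHS]mulrA ler_pM2l ?divr_gt0 //.
  have -> : (1 + 4 * y) * (1 - delta) ^+ 2 =
      1 + y + y * (1 - 4 * y) + y * (1 + y / 4 + y ^+ 2).
    by rewrite /delta; field.
  have h1 : 0 <= y * (1 - 4 * y) by rewrite mulr_ge0 ?subr_ge0 // ltW.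
  have h2 : 0 <= y * (1 + y / 4 + y ^+ 2).
    by rewrite mulr_ge0 ?addr_ge0 ?divr_ge0 ?sqr_ge0 // ltW.
  lra.
have c'cb : c' <= cb.
  apply: (le_trans c'le); have := ler_wpM2l (ltW cb0) yle; lra.
have c'0 : 0 < c' by rewrite divr_gt0 ?exprn_gt0.
set n := #|X|%:R in S1 S2 N' H1 H2; set n' := #|X'|%:R in N' H1 H2.
have n0 : 0 < n by rewrite /n ltr0n card_gt0.
have usq : 256 * u ^+ 2 <= 1.
  have : (16 * u) ^+ 2 <= 1 by rewrite expr_le1 // ?mulr_ge0 ?(ltW u0) //; lra.
  rewrite exprMn; lra.
have nn' : n <= 103 / 100 * n'.
  have := ler_wpM2l (ltW n0) usq; move: N' n0; clear; lra.
have n'0 : 0 < n' by move: nn' n0; clear; lra.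
exists w', X'; split; last exact: w'w.
split.
- by rewrite -card_gt0 -(ltr0n R).
- by apply: weightingW w'X'; rewrite y'E.
- have eta0 : 0 < u ^+ 2 / 16 by rewrite divr_gt0.
  apply: (le_trans (H1 _ eta0)).
  have r1 : \sum_(v in X) excess w delta v <= 3 / 56 * u ^+ 2 * n.
    apply: (@le_trans _ _ (\sum_(v in X) deficit w v ^+ 2 / (4 * delta) / (1 - delta))).
      by apply: ler_sum => v _; apply: excess_le_sqr.
    rewrite -!mulr_suml ler_pdivrMr // ler_pdivrMr; last by rewrite mulr_gt0.
    apply: (le_trans S2).
    have cbn : 0 <= cb * n by rewrite mulr_ge0 // ltW.
    have h1 : 0 <= cb * n * u by rewrite mulr_ge0 // ltW.
    have h2 := ler_wpM2l cbn d1'; move: (1 - delta) h2 => d' h2.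
    have -> : 3 / 56 * u ^+ 2 * n * d' * (4 * delta) =
      3 / 28 * (y * u ^+ 2) * n * d' by rewrite /delta; field.
    rewrite yE; move: h1 h2 cbn; clear; lra.
  have -> : 3 * c' * u ^+ 2 * n / (4 * (u ^+ 2 / 16)) = 12 * (c' * n).
    by field; rewrite gt_eqF.
  have r3 : 32 * (c' * n) <= y * u ^+ 2 * n.
    by rewrite yE mulrA ler_pM2r // ler_pM2l.
  have r4 : u ^+ 2 * n <= 103 / 100 * (u ^+ 2 * n') by rewrite mulrCA ler_pM2l.
  have r5 : 4 * (y * u ^+ 2 * n) <= u ^+ 2 * n.
    have := ler_wpM2r (ltW (mulr_gt0 u20 n0)) yle; rewrite mul1r; clear; lra.
  have -> : (u / 2) ^+ 2 * #|X'|%:R = u ^+ 2 * n' / 4 by rewrite /n'; field.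
  have -> : u ^+ 2 / 16 * n' = u ^+ 2 * n' / 16 by field.
  have r6 := mulr_gt0 u20 n'0.
  rewrite -mulrA in r1; move: (\sum_(v in X) _) (c' * n) (y * _ * n) (u ^+ 2 * n) (u ^+ 2 * n') r1 r3 r4 r5 r6.
  clear => e1 e2 e3 e4 e5; lra.
(* With [theta = u], the factor [1 + u] and the fluctuations both cost O(u), which the passage from
   [1 - 8 * u] to [1 - 4 * u] pays for. *)
- apply: (le_trans (H2 u u0)).
  have r1 : \sum_(v in X) excess w delta v ^+ 2 <= 3 * cb * (1 - 8 * u) * n.
    apply: le_trans S2; apply: ler_sum => v _.
    have := excess_le v wX d01; have := deficit_bounds v wX.
    move=> /andP[s0 _] le1; rewrite ler_sqr ?nnegrE //.
    by apply: excess_ge0; case/andP: d01.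
  have -> : (1 + u^-1) * (6 * c' * u ^+ 2 * n) = (1 + u) * (6 * u) * (c' * n).
    by field; rewrite gt_eqF.
  have u1 : 0 <= 1 + u by rewrite addr_ge0 // ltW.
  have r3 : (1 + u) * (6 * u) * (c' * n) <= (1 + u) * (6 * u) * (cb * n).
    by apply: ler_wpM2l; [rewrite !mulr_ge0 // ltW | rewrite ler_pM2r].
  have r4 := ler_wpM2l u1 r1.
  apply: (le_trans (lerD r4 r3)).
  have cbn : 0 < cb * n by rewrite mulr_gt0.
  apply: (@le_trans _ _ (3 * cb * (1 - 4 * u) * ((1 - 3 * u ^+ 2) * n))).
    rewrite -subr_ge0.
    have -> : 3 * cb * (1 - 4 * u) * ((1 - 3 * u ^+ 2) * n) -
      ((1 + u) * (3 * cb * (1 - 8 * u) * n) + (1 + u) * (6 * u) * (cb * n)) =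
      cb * n * (u * (3 + 9 * u + 36 * u ^+ 2)) by ring.
    apply: mulr_ge0; first exact: ltW.
    by rewrite mulr_ge0 ?addr_ge0 ?mulr_ge0 ?sqr_ge0 // ltW.
  have -> : 8 * (u / 2) = 4 * u by field.
  apply: ler_wpM2l; last exact: ltW.
  by rewrite !mulr_ge0 ?(ltW cb0) //; lra.
Qed.

(** With [delta = 9 / 16] the excess vanishes and only fluctuations of order [c] remain. The cap
    grows by 256/49, which is below 11/2. *)
Lemma stage_first w X c : 0 < c -> c * 500 * 500 <= 1 -> X != set0 -> weighting w X c ->
  (forall v, v \in X -> deficit w v <= 9 / 16) ->
  \sum_(v in X) deficit w v <= 1 / 8 * #|X|%:R ->
  exists w' X', stage w' X' (11 * c) (1 / 16) /\ supported_by w w'.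
Proof.
move=> c0 cle X0 wX smax S1.
have d01 : 0 < (9 / 16 : R) < 1 by lra.
have t0 : 0 < 1 / 8 :> R by lra.
have [X' [w' [[w'X' w'w] X'X N' H1 H2]]] := thinning wX d01 X0 c0 t0 S1.
have cE : c / (1 - 9 / 16) ^+ 2 = 256 / 49 * c by field.
rewrite cE in w'X' H1 H2.
have ex0 v : v \in X -> excess w (9 / 16) v = 0.
  by move=> vX; rewrite /excess max_r ?mul0r // subr_le0 smax.
set n := #|X|%:R in S1 N' H1 H2; set n' := #|X'|%:R in N' H1 H2.
have n0 : 0 < n by rewrite /n ltr0n card_gt0.
have n'0 : 0 < n' by lra.
have cn : c * n <= 8 / 5 * (c * n').
  have : c * n <= c * (8 / 5 * n') by rewrite ler_pM2l //; lra.
  lra.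
have cn'0 : 0 < c * n' by rewrite mulr_gt0.
have cn' : 500 * (500 * (c * n')) <= n'.
  by have := ler_wpM2r (ltW n'0) cle; rewrite mul1r; lra.
exists w', X'; split; last exact: w'w.
have uE : (1 / 16) ^+ 2 = 1 / 256 :> R by field.
split.
- by rewrite -card_gt0 -(ltr0n R).
- apply: weightingW w'X'.
  have : 0 <= 32 * (11 * c) / (1 / 16) ^+ 2 by rewrite divr_ge0 ?sqr_ge0 // !mulr_ge0 // ltW.
  move/(ler_wpM2l (ltW c0)); lra.
- have eta0 : 0 < 1 / 512 :> R by lra.
  apply: (le_trans (H1 _ eta0)); rewrite big1 => [|v /ex0//]; rewrite uE.
  have -> : 3 * (256 / 49 * c) * (1 / 8) * n / (4 * (1 / 512)) = 256 * 48 / 49 * (c * n).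
    by field.
  lra.
- apply: (le_trans (H2 1 ltr01)).
  rewrite big1 => [|v vX]; last by rewrite ex0 // expr0n.
  rewrite invr1; lra.
Qed.

(** [u] is halved until [u ^+ 2 <= 128 * cb]; it stops above [32 * cb], where the cap is still at
    most [cb]. *)
Lemma stage_last w X cb u : 0 < cb -> 0 < u <= 1 / 16 -> 32 * cb <= u ^+ 2 ->
  stage w X cb u -> exists w' X', [/\ X' != set0, weighting w' X' cb,
    \sum_(v in X') deficit w' v <= 128 * cb * #|X'|%:R & supported_by w w'].
Proof.
move=> cb0 u01 cbu wX.
have [k le_uk] : exists k, u ^+ 2 <= 4 ^+ k * (128 * cb).
  pose a := u ^+ 2 / (128 * cb).
  have a0 : 0 <= a by rewrite divr_ge0 ?sqr_ge0 // mulr_ge0 // ltW.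
  exists (Num.bound a); rewrite -ler_pdivrMr ?mulr_gt0 // -/a ltW //.
  apply: (lt_le_trans (archi_boundP a0)); rewrite -natrX ler_nat.
  exact: ltnW (ltn_expl _ _).
have done w1 X1 u1 : 0 < u1 -> 32 * cb <= u1 ^+ 2 -> u1 ^+ 2 <= 128 * cb ->
    stage w1 X1 cb u1 -> exists w' X', [/\ X' != set0, weighting w' X' cb,
    \sum_(v in X') deficit w' v <= 128 * cb * #|X'|%:R & supported_by w1 w'].
  move=> u10 lo hi [X10 w1X1 S1 _]; exists w1, X1; split=> //.
    apply: weightingW w1X1; rewrite -[leRHS]mulr1 -mulrA ler_pM2l //.
    have : 32 * cb / u1 ^+ 2 <= 1 by rewrite ler_pdivrMr ?exprn_gt0 // mul1r.
    lra.
  by apply: (le_trans S1); apply: ler_wpM2r.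
elim: k w X u u01 cbu wX le_uk => [|k IHk] w X u /andP[u0 u16] cbu wX le_uk.
  by apply: done wX => //; move: le_uk; rewrite expr0 mul1r.
have [small|large] := lerP (u ^+ 2) (128 * cb); first exact: done wX.
have u01 : 0 < u <= 1 / 16 by rewrite u0.
have [w1 [X1 [st1 ww1]]] := stage_step cb0 u01 (ltW large) wX.
have [||| w2 [X2 [X20 w2X2 S2 w12]]] := IHk w1 X1 (u / 2) _ _ st1.
- by apply/andP; split; lra.
- rewrite exprMn; lra.
- rewrite exprMn; move: le_uk; rewrite (exprS 4); move: (4 ^+ k) => K; lra.
by exists w2, X2; split=> //; apply: supported_trans w12.
Qed.

Lemma regularisation w X c : 0 < c -> c * 500 * 500 <= 1 -> X != set0 -> weighting w X c ->
  (forall v, v \in X -> deficit w v <= 9 / 16) ->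
  \sum_(v in X) deficit w v <= 1 / 8 * #|X|%:R ->
  exists w' X', [/\ X' != set0, weighting w' X' (11 * c),
    \sum_(v in X') deficit w' v <= 128 * (11 * c) * #|X'|%:R & supported_by w w'].
Proof.
move=> c0 cle X0 wX smax S1.
have [w1 [X1 [st1 ww1]]] := stage_first c0 cle X0 wX smax S1.
have [||| w2 [X2 [X20 w2X2 S2 w12]]] := stage_last _ _ _ st1.
- by rewrite mulr_gt0.
- lra.
- have -> : (1 / 16) ^+ 2 = 1 / 256 :> R by field.
  lra.
by exists w2, X2; split=> //; apply: supported_trans w12.
Qed.
End Regularisation.

(** * Regular subgraphs of almost regular bipartite graphs *)

(** A set [S] minimising [Psi] has [Psi S <= Psi X < 0], which bounds its average deficit by 1/8.
    Removing a vertex changes [Psi] by [2 * d S v - 7 / 8], so every degree inside [S] is at least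
    7/16. *)
Lemma cleaning (R : realFieldType) (V : finType) (w : V -> V -> R) X c :
  weighting w X c -> \sum_(v in X) deficit w v < 1 / 8 * #|X|%:R ->
  exists w1 X1, [/\ X1 != set0, weighting w1 X1 c,
    forall v, v \in X1 -> deficit w1 v <= 9 / 16,
    \sum_(v in X1) deficit w1 v <= 1 / 8 * #|X1|%:R &
    forall u v, w u v = 0 -> w1 u v = 0].
Proof.
move=> [wsym w0c wvv wX wd1] defX.
have w0 u v : 0 <= w u v by case/andP: (w0c u v).
pose d (S : {set V}) v := \sum_(u in S) w v u.
pose e (S : {set V}) := \sum_(v in S) d S v.
pose Psi (S : {set V}) := 7 / 8 * #|S|%:R - e S.
pose P (S : {set V}) := true.
have PX : P X by [].
case: (arg_minP Psi PX) => S _ minS.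
have sumd v : v \in X -> wdeg w v = d X v.
  move=> vX; rewrite /wdeg (bigID (mem X)) /= [X in _ + X]big1 ?addr0 // => u uX.
  exact: wX.
have PsiX : Psi X < 0.
  rewrite /Psi; move: defX; rewrite (eq_bigr (fun v => 1 - d X v)); last first.
    by move=> v vX; rewrite /deficit sumd.
  rewrite big_split /= sumr_const sumrN -/(e X); move: (e X) (#|X|%:R) => a b; lra.
have PsiS : Psi S < 0 by apply: le_lt_trans PsiX; apply: minS.
have S0 : S != set0.
  by apply: contraTneq PsiS => ->; rewrite /Psi /e cards0 big_set0 mulr0 subrr ltxx.
have dS v : v \in S -> 7 / 16 <= d S v.
  move=> vS; have := minS (S :\ v) isT.
  have dv : d S v = \sum_(u in S :\ v) w v u by rewrite /d (big_setD1 v) //= wvv add0r.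
  have eS : e S = e (S :\ v) + 2 * d S v.
    rewrite /e (big_setD1 v) //=.
    have -> : \sum_(u in S :\ v) d S u = \sum_(u in S :\ v) d (S :\ v) u + d S v.
      rewrite dv -big_split; apply: eq_bigr => u _.
      by rewrite /d (big_setD1 v) //= wsym addrC.
    by ring.
  rewrite /Psi eS (cardsD1 v S) vS natrD mulr1n.
  by move: (d S v) (e _) (#|_|%:R) => a b k; lra.
pose w1 u v := if (u \in S) && (v \in S) then w u v else 0.
have wdeg1 v : v \in S -> wdeg w1 v = d S v.
  move=> vS; rewrite /wdeg /d [RHS]big_mkcond; apply: eq_bigr => u _.
  by rewrite /w1 vS.
exists w1, S; split=> //.
- split.
  + by move=> u v; rewrite /w1 andbC wsym.
  + move=> u v; rewrite /w1; case: ifP => _ //.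
    by case/andP: (w0c u v) => a b; rewrite lexx (le_trans a b).
  + by move=> v; rewrite /w1 wvv if_same.
  + by move=> u v /negbTE vS; rewrite /w1 vS andbF.
  + move=> v; apply: le_trans (wd1 v); apply: ler_sum => u _.
    by rewrite /w1; case: ifP.
- by move=> v vS; rewrite /deficit wdeg1 //; have := dS v vS; lra.
- rewrite (eq_bigr (fun v => 1 - d S v)); last by move=> v vS; rewrite /deficit wdeg1.
  move: PsiS; rewrite /Psi big_split /= sumr_const sumrN -/(e S).
  by move: (e S) (#|S|%:R) => a b; lra.
- by move=> u v wuv; rewrite /w1 wuv if_same.
Qed.

(** * Rounding bipartite weights to 0 and 1 *)

Section BipartiteRounding.
Variables (R : archiRealFieldType).

Lemma natr_card (K : finType) (P : pred K) : #|[set k | P k]|%:R = \sum_k (P k)%:R :> R.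
Proof.
rewrite -sum1_card natr_sum big_mkcond; apply: eq_bigr => k _.
by rewrite inE; case: (P k).
Qed.

Lemma int01 (x : R) : x \is a Num.int -> 0 <= x <= 1 -> x = (x == 1)%:R.
Proof.
move=> /intrP[k ->] /andP[x0 x1]; have := x0; have := x1.
rewrite -[1]/(1%:~R) -[0 in X in _ -> X -> _]/(0%:~R) !ler_int eqr_int => k1 k0.
by have [->|->] : k = 0 \/ k = 1 by lia.
Qed.

(* Slack variables, in a new row and a new column, turn the degree bounds into integral
   row and column sums; the corner entry is the total weight. *)
Lemma bipartite_rounding (I J : finType) (z : I -> J -> R) (m : nat) :
  (forall i j, 0 <= z i j <= 1) ->
  (forall i, \sum_j z i j <= m%:R) -> (forall j, \sum_i z i j <= m%:R) ->
  exists E : I -> J -> bool, [/\ forall i j, E i j -> z i j != 0,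
    forall i, (#|[set j | E i j]| <= m)%N, forall j, (#|[set i | E i j]| <= m)%N &
    \sum_i \sum_j z i j <= (\sum_i #|[set j | E i j]|)%N%:R].
Proof.
move=> z01 rowz colz.
pose Z (i : option I) (j : option J) : R := match i, j with
  | Some i, Some j => z i j
  | Some i, None => m%:R - \sum_j z i j
  | None, Some j => m%:R - \sum_i z i j
  | None, None => \sum_i \sum_j z i j end.
have opt (K : finType) (f : option K -> R) : \sum_k f k = f None + \sum_k f (Some k).
  rewrite (bigD1 None) //=; congr (_ + _).
  rewrite (reindex_omap Some id) => [|[]//]; apply: eq_bigl => k; exact: eqxx.
have row i : \sum_j Z i j = if i is Some _ then m%:R else m%:R * #|J|%:R.
  rewrite opt; case: i => [i|] /=; first by rewrite subrK.
  by rewrite big_split sumr_const sumrN /= [X in _ - X]exchange_big /= addrC subrK mulr_natr.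
have col j : \sum_i Z i j = if j is Some _ then m%:R else m%:R * #|I|%:R.
  rewrite opt; case: j => [j|] /=; first by rewrite subrK.
  by rewrite big_split sumr_const sumrN /= addrCA subrr addr0 mulr_natr.
have [||Z' [intZ' roundZ' rowZ' colZ' leZ']] := @matrix_rounding R _ _ Z None None.
- by move=> [i|]; rewrite row ?rpredM ?natr_int.
- by move=> [j|]; rewrite col ?rpredM ?natr_int.
have Z01 i j : Z' (Some i) (Some j) = (Z' (Some i) (Some j) == 1)%:R.
  apply: int01 => //; case/andP: (z01 i j) => z0 z1.
  by rewrite ((roundZ' (Some i) (Some j) 0).1 z0) ((roundZ' (Some i) (Some j) 1).2 z1).
pose E i j := Z' (Some i) (Some j) == 1.
have slack_row i : 0 <= Z' (Some i) None.
  by apply: (roundZ' (Some i) None 0).1; rewrite /= subr_ge0.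
have slack_col j : 0 <= Z' None (Some j).
  by apply: (roundZ' None (Some j) 0).1; rewrite /= subr_ge0.
exists E; split.
- move=> i j; apply: contraTneq => zij; rewrite /E; apply/eqP => Z1.
  by have := (roundZ' (Some i) (Some j) 0).2; rewrite /= zij lexx Z1 => /(_ isT); rewrite ler10.
- move=> i; rewrite -(ler_nat R) natr_card (eq_bigr (fun j => Z' (Some i) (Some j))) => [|j _]; last exact/esym/Z01.
  by have := rowZ' (Some i); rewrite row opt; have := slack_row i; lra.
- move=> j; rewrite -(ler_nat R) natr_card (eq_bigr (fun i => Z' (Some i) (Some j))) => [|i _]; last exact/esym/Z01.
  by have := colZ' (Some j); rewrite col opt; have := slack_col j; lra.
- apply: (le_trans leZ'); rewrite natr_sum.
  have -> : \sum_i #|[set j | E i j]|%:R = \sum_i \sum_j Z' (Some i) (Some j).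
    by apply: eq_bigr => i _; rewrite natr_card; apply: eq_bigr => j _; rewrite -Z01.
  (* Eliminating the slacks through the columns and the new row shows that the rounded entries total
     the rounded corner. *)
  rewrite exchange_big /=.
  have -> : \sum_j \sum_i Z' (Some i) (Some j) = \sum_(j : J) (m%:R - Z' None (Some j)).
    by apply: eq_bigr => j _; have := colZ' (Some j); rewrite col opt => <-; ring.
  rewrite big_split sumr_const sumrN /=.
  have := rowZ' None; rewrite row opt => h; rewrite -mulr_natr; lra.
Qed.

(** The constant weight [r / q] on the edges has row and column sums 0 or [r], which rounding
    preserves. *)
Lemma regular_rounding (I J : finType) (E : I -> J -> bool) (q r : nat) :
  (0 < q)%N -> (r <= q)%N -> (exists i j, E i j) ->
  (forall i, #|[set j | E i j]| = 0 \/ #|[set j | E i j]| = q)%N ->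
  (forall j, #|[set i | E i j]| = 0 \/ #|[set i | E i j]| = q)%N ->
  exists E' : I -> J -> bool, [/\ forall i j, E' i j -> E i j,
    forall i, #|[set j | E' i j]| = if #|[set j | E i j]| == 0%N then 0%N else r &
    forall j, #|[set i | E' i j]| = if #|[set i | E i j]| == 0%N then 0%N else r].
Proof.
move=> q0 rq [i0 [j0 _]] rowE colE.
have q0' : q%:R != 0 :> R by rewrite pnatr_eq0 -lt0n.
pose Z i j : R := (E i j)%:R * (r%:R / q%:R).
have row i : \sum_j Z i j = (if #|[set j | E i j]| == 0%N then 0%N else r)%:R.
  rewrite -mulr_suml -natr_card; case: (rowE i) => ->; first by rewrite eqxx mul0r.
  by rewrite -[q == 0%N](negbK) -lt0n q0 mulrC divfK.
have col j : \sum_i Z i j = (if #|[set i | E i j]| == 0%N then 0%N else r)%:R.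
  rewrite -mulr_suml -natr_card; case: (colE j) => ->; first by rewrite eqxx mul0r.
  by rewrite -[q == 0%N](negbK) -lt0n q0 mulrC divfK.
have [||Z' [intZ' roundZ' rowZ' colZ' _]] := @matrix_rounding R _ _ Z i0 j0.
- by move=> i; rewrite row natr_int.
- by move=> j; rewrite col natr_int.
have rq1 : 0 <= (r%:R / q%:R : R) <= 1.
  by rewrite divr_ge0 // ler_pdivrMr ?mul1r ?ler_nat ?ltr0n.
have Z01 i j : Z' i j = (Z' i j == 1)%:R.
  apply: int01 => //; rewrite ((roundZ' i j 0).1 _) ?((roundZ' i j 1).2 _) // /Z.
    by case: (E i j); rewrite ?mul1r ?mul0r //; case/andP: rq1.
  by case: (E i j); rewrite ?mul1r ?mul0r //; case/andP: rq1.
exists (fun i j => Z' i j == 1); split.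
- move=> i j /eqP Z1; have := (roundZ' i j 0).2; rewrite /Z Z1.
  by case: (E i j) => //; rewrite mul0r lexx => /(_ isT); rewrite ler10.
- move=> i; apply/eqP; rewrite -(eqr_nat R) natr_card -row -rowZ'.
  by apply/eqP/eq_bigr => j _; rewrite -Z01.
- move=> j; apply/eqP; rewrite -(eqr_nat R) natr_card -col -colZ'.
  by apply/eqP/eq_bigr => i _; rewrite -Z01.
Qed.
End BipartiteRounding.

Definition incident (V : finType) (e : V * V) v := (e.1 == v) || (e.2 == v).

Lemma card_star (V : finType) (s : {set V}) (x : {set V * V}) v :
  (forall a b, (a, b) \in x -> (a \in s) && (b \notin s)) ->
  #|star (@incident V) x v| =
  if v \in s then #|[set b | (v, b) \in x]| else #|[set a | (a, v) \in x]|.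
Proof.
move=> xs; case: ifP => vs.
  have inj_v : injective (fun b : V => (v, b)) by move=> b b' [].
  rewrite -(card_imset [set b | (v, b) \in x] inj_v).
  apply: eq_card => -[a b]; rewrite inE /incident /=; apply/andP/imsetP.
    case=> ab /orP[/eqP av|/eqP bv]; first by exists b; rewrite ?inE -?av.
    by have := xs _ _ ab; rewrite bv vs andbF.
  by case=> b'; rewrite inE => vb' [-> ->]; rewrite eqxx.
have inj_v : injective (fun a : V => (a, v)) by move=> a a' [].
rewrite -(card_imset [set a | (a, v) \in x] inj_v).
apply: eq_card => -[a b]; rewrite inE /incident /=; apply/andP/imsetP.
  case=> ab /orP[/eqP av|/eqP bv]; last by exists a; rewrite ?inE -?bv.
  by have := xs _ _ ab; rewrite av vs.
by case=> a'; rewrite inE => va' [-> ->]; rewrite eqxx orbT.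
Qed.

Lemma card_pairs (V : finType) (E : rel V) :
  #|[set e : V * V | E e.1 e.2]| = (\sum_a #|[set b | E a b]|)%N.
Proof.
rewrite -sum1_card (eq_bigl (fun e : V * V => true && E e.1 e.2)); last by move=> e; rewrite inE.
rewrite -(pair_big_dep xpredT (fun a b => E a b) (fun _ _ => 1%N)) /=.
by apply: eq_bigr => a _; rewrite -sum1_card; apply: eq_bigl => b; rewrite inE.
Qed.

(** Rounding [m * w] with [m = 2 * q - 1] gives degrees below [2 * q] and, as [m * tau < 1], more
    than [(q - 1) * #|X|] edges. So [divisible_degrees] yields degrees 0 or [q], and
    [regular_rounding] turns [q] into [r]. *)
Lemma biregular_relation (R : archiRealFieldType) (V : finType) (s : {set V})
    (w : V -> V -> R) X c tau k r :
  (0 < r <= 2 ^ k)%N -> X != set0 -> weighting w X c ->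
  \sum_(v in X) deficit w v <= tau * #|X|%:R ->
  (forall u v, w u v != 0 -> (u \in s) != (v \in s)) ->
  (2 * 2 ^ k - 1)%:R * c <= 1 -> (2 * 2 ^ k - 1)%:R * tau < 1 ->
  exists E : rel V, [/\ exists a b, E a b,
    forall a b, E a b -> [&& a \in s, b \notin s & w a b != 0],
    forall a, outdeg E a = 0%N \/ outdeg E a = r &
    forall b, indeg E b = 0%N \/ indeg E b = r].
Proof.
move=> /andP[r0 rq] X0 [wsym w0c wvv wX wd1] defX wbip mc mtau.
set q := (2 ^ k)%N in rq mc mtau; set m := (2 * q - 1)%N in mc mtau.
have q0 : (0 < q)%N by rewrite expn_gt0.
have w0 u v : 0 <= w u v by case/andP: (w0c u v).
have m0 : 0 <= m%:R :> R by [].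
pose cut a b := (a \in s) && (b \notin s).
pose z a b : R := if cut a b then m%:R * w a b else 0.
have zle a b : 0 <= z a b <= m%:R * w a b.
  by rewrite /z; case: ifP => _; rewrite ?lexx ?mulr_ge0.
have [|||E1 [E1z rowE1 colE1 sumE1]] := @bipartite_rounding R V V z m.
- move=> a b; case/andP: (zle a b) => -> /= /le_trans; apply.
  by apply: le_trans mc; apply: ler_wpM2l => //; case/andP: (w0c a b).
- move=> a; apply: (@le_trans _ _ (m%:R * wdeg w a)).
    by rewrite mulr_sumr; apply: ler_sum => b _; case/andP: (zle a b).
  by rewrite -[leRHS]mulr1; apply: ler_wpM2l.
- move=> b; apply: (@le_trans _ _ (m%:R * wdeg w b)).
    by rewrite mulr_sumr; apply: ler_sum => a _; rewrite (wsym b); case/andP: (zle a b).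
  by rewrite -[leRHS]mulr1; apply: ler_wpM2l.
(* [z] keeps only the orientation from [s] to its complement, hence the factor 2. *)
have total : 2 * (\sum_a \sum_b z a b) = m%:R * (#|X|%:R - \sum_(v in X) deficit w v).
  have -> : #|X|%:R - \sum_(v in X) deficit w v = \sum_v wdeg w v.
    rewrite [RHS](bigID (mem X)) /= [X in _ = _ + X]big1 ?addr0; last first.
      by move=> v vX; apply: big1 => u _; rewrite wsym wX.
    rewrite -sum1_card natr_sum -sumrN -big_split /=; apply: eq_bigr => v _.
    by rewrite /deficit opprB addrC subrK.
  have -> : 2 * (\sum_a \sum_b z a b) = \sum_a \sum_b z a b + \sum_a \sum_b z b a.
    by rewrite [X in _ = _ + X]exchange_big /=; ring.
  rewrite mulr_sumr -big_split; apply: eq_bigr => a _.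
  rewrite -big_split mulr_sumr; apply: eq_bigr => b _ /=.
  rewrite /z /cut (wsym b a); have [->|/wbip] := eqVneq (w a b) 0.
    by rewrite mulr0 !if_same addr0.
  by case: (a \in s); case: (b \in s) => //= _; rewrite ?addr0 ?add0r.
pose E := [set e : V * V | E1 e.1 e.2].
have Ecut a b : (a, b) \in E -> cut a b && (w a b != 0).
  rewrite inE => /E1z; rewrite /z; case: (cut a b); rewrite ?eqxx //=.
  by apply: contraNneq => ->; rewrite mulr0.
have Es a b : (a, b) \in E -> (a \in s) && (b \notin s) by move/Ecut/andP => [].
have cardE : ((q - 1) * #|X| < #|E|)%N.
  rewrite card_pairs -(ltr_nat R); apply: lt_le_trans sumE1.
  have N0 : 0 < #|X|%:R :> R by rewrite ltr0n card_gt0.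
  have mE : m%:R = 2 * q%:R - 1 :> R by rewrite natrB ?natrM; last by lia.
  rewrite natrM natrB // -(ltr_pM2l (ltr0n R 2)) total.
  apply: (@lt_le_trans _ _ (m%:R * (#|X|%:R - tau * #|X|%:R))).
    have := mtau; rewrite -(ltr_pM2r N0) mE.
    by move: (#|X|%:R) => n; lra.
  by apply: ler_wpM2l; rewrite ?lerD2l ?lerN2.
have starE v : (#|star (@incident V) E v| < 2 * q)%N.
  have lem (n : nat) : (n <= m)%N -> (n < 2 * q)%N by rewrite /m; lia.
  apply: lem; rewrite (card_star _ Es); case: ifP => _.
    by apply: leq_trans (rowE1 v); apply/subset_leq_card/subsetP => b; rewrite !inE.
  by apply: leq_trans (colE1 v); apply/subset_leq_card/subsetP => a; rewrite !inE.
have [x [xE x0 degx]] := divisible_degrees cardE (fun v _ => starE v).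
have xcut a b : (a, b) \in x -> cut a b && (w a b != 0) by move/(subsetP xE)/Ecut.
have xs a b : (a, b) \in x -> (a \in s) && (b \notin s) by move/xcut/andP => [].
have degx' v : #|star (@incident V) x v| = 0%N \/ #|star (@incident V) x v| = q.
  have [/degx//|vX] := boolP (v \in X); left; apply/eqP; rewrite cards_eq0.
  apply/eqP/setP => -[a b]; rewrite !inE; apply/negP => /andP[/xcut/andP[_ wab]].
  case/orP => /eqP /= e; move: wab; last by rewrite wX ?eqxx // e.
  by rewrite wsym wX ?eqxx // e.
have rowx a : #|[set b | (a, b) \in x]| = 0%N \/ #|[set b | (a, b) \in x]| = q.
  have [as_|as_] := boolP (a \in s); first by have := degx' a; rewrite (card_star _ xs) as_.
  left; apply: eq_card0 => b; rewrite inE; apply/negP => /xs.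
  by rewrite (negbTE as_).
have colx b : #|[set a | (a, b) \in x]| = 0%N \/ #|[set a | (a, b) \in x]| = q.
  have [bs|bs] := boolP (b \in s); last by have := degx' b; rewrite (card_star _ xs) (negbTE bs).
  left; apply: eq_card0 => a; rewrite inE; apply/negP => /xs.
  by rewrite bs andbF.
have [a [b abx]] : exists a b, (a, b) \in x.
  by case/set0Pn: x0 => -[a b] abx; exists a, b.
have [E' [E'x rowE' colE']] := @regular_rounding R V V (fun a b => (a, b) \in x)
  q r q0 rq (ex_intro _ a (ex_intro _ b abx)) rowx colx.
exists E'; split.
- have : (0 < #|[set b | E' a b]|)%N.
    rewrite rowE' ifN // -lt0n card_gt0; apply/set0Pn; exists b.
    by rewrite inE.
  by rewrite card_gt0 => /set0Pn[b']; rewrite inE => E'ab'; exists a, b'.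
- by move=> a' b' /E'x/xcut/andP[/andP[-> ->] ->].
- by move=> a'; rewrite /outdeg rowE'; case: ifP; [left | right].
- by move=> b'; rewrite /indeg colE'; case: ifP; [left | right].
Qed.

(** The relation is symmetrised and its isolated vertices are dropped, which rules out degree 0. *)
Lemma regular_subgraph_of_relation (V : finType) (G : sgraph V) (s : {set V}) (E : rel V) r :
  (0 < r)%N -> (exists a b, E a b) ->
  (forall a b, E a b -> [&& a \in s, b \notin s & adj G a b]) ->
  (forall a, outdeg E a = 0%N \/ outdeg E a = r) ->
  (forall b, indeg E b = 0%N \/ indeg E b = r) ->
  exists H : sgraph V, subgraph H G /\ regular r H.
Proof.
move=> r0 [a0 [b0 E0]] Es outE inE'.
pose e a b := E a b || E b a.
pose W := [set a | [exists b, e a b]].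
have W0 : W != set0.
  by apply/set0Pn; exists a0; rewrite inE; apply/existsP; exists b0; rewrite /e E0.
have esym : symmetric e by move=> a b; rewrite /e orbC.
have eW a b : e a b -> (a \in W) && (b \in W).
  move=> eab; rewrite !inE; apply/andP; split; apply/existsP; first by exists b.
  by exists a; rewrite esym.
have eirr : irreflexive e.
  by move=> a; rewrite /e orbb; apply/negP => /Es/and3P[-> ].
have eG a b : e a b -> adj G a b.
  by case/orP => /Es/and3P[_ _] //; rewrite adj_sym.
exists (SGraph W0 eW esym eirr); split.
  split; last exact: eG.
  by apply/subsetP => a; rewrite inE => /existsP[b /eG/adj_vertices/andP[]].
move=> a; rewrite /= inE => /existsP[b eab].
have pos (n : nat) : (0 < n)%N -> n = 0%N \/ n = r -> n = r by move=> n0 [n1|//]; rewrite n1 in n0.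
have [as_|as_] := boolP (a \in s).
  have -> : degree (SGraph W0 eW esym eirr) a = outdeg E a.
    apply: eq_card => y; rewrite !inE /= /e; case: (boolP (E y a)) => [/Es/and3P[_]|].
      by rewrite as_.
    by rewrite orbF.
  apply: pos (outE a); rewrite card_gt0; apply/set0Pn; exists b; rewrite inE.
  by case/orP: eab => // /Es/and3P[_]; rewrite as_.
have -> : degree (SGraph W0 eW esym eirr) a = indeg E a.
  apply: eq_card => y; rewrite !inE /= /e; case: (boolP (E a y)) => [/Es/and3P[]|//].
  by rewrite (negbTE as_).
apply: pos (inE' a); rewrite card_gt0; apply/set0Pn; exists b; rewrite inE.
by case/orP: eab => // /Es/and3P[]; rewrite (negbTE as_).
Qed.

(** Edges of the block get weight [1 / t]. Vertices of [A'] and [B'] have deficit 0 and the others,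
    at most 1/16 of all, deficit at most 1; cleaning, regularisation and rounding follow. *)
Lemma biregular_of_block (R : archiRealFieldType) (V : finType) (s A0 B0 A' B' : {set V})
    (F : rel V) (t k r : nat) :
  A0 != set0 -> #|A0| = #|B0| -> A' \subset A0 -> B' \subset B0 -> #|A'| = #|B'| ->
  (15 * #|A0| <= 16 * #|A'|)%N -> A0 \subset s -> [disjoint B0 & s] ->
  (forall a b, F a b -> (a \in A0) && (b \in B0)) ->
  (forall a, outdeg F a <= t)%N -> (forall b, indeg F b <= t)%N ->
  {in A', forall a, outdeg F a = t} -> {in B', forall b, indeg F b = t} ->
  (0 < r <= 2 ^ k)%N -> 500 * 500 <= t%:R :> R ->
  (2 * 2 ^ k - 1)%:R * (128 * 11) < t%:R :> R ->
  exists E : rel V, [/\ exists a b, E a b,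
    forall a b, E a b -> [&& a \in s, b \notin s & F a b],
    forall a, outdeg E a = 0%N \/ outdeg E a = r &
    forall b, indeg E b = 0%N \/ indeg E b = r].
Proof.
move=> A00 eAB A'A B'B eA'B' le15 As Bs FAB outF inF regA regB rk t500 tk.
have t0 : 0 < t%:R :> R by apply: lt_le_trans t500; rewrite mulr_gt0.
have notB b : b \in B0 -> b \notin s by move=> bB; rewrite (disjointFr Bs).
have Fs a b : F a b -> (a \in s) && (b \notin s).
  by move/FAB/andP => [aA bB]; rewrite (subsetP As) //= notB.
pose X := A0 :|: B0.
have X0 : X != set0 by case/set0Pn: A00 => a aA; apply/set0Pn; exists a; rewrite inE aA.
pose w u v : R := (F u v || F v u)%:R / t%:R.
have wdegE v : wdeg w v = (if v \in s then outdeg F v else indeg F v)%:R / t%:R.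
  rewrite /wdeg /w -mulr_suml; congr (_ / _).
  have -> : (if v \in s then outdeg F v else indeg F v) = #|[set u | F v u || F u v]|.
    case: ifP => vs; apply: eq_card => u; rewrite !inE.
      by case: (boolP (F u v)) => [/Fs|_]; rewrite ?vs ?andbF ?orbF.
    by case: (boolP (F v u)) => [/Fs|_] //; rewrite vs.
  by rewrite natr_card.
have wX : weighting w X (t%:R^-1).
  split.
  - by move=> u v; rewrite /w orbC.
  - move=> u v; rewrite /w; case: (_ || _); by rewrite ?mul1r ?mul0r ?lexx ?andbT invr_ge0 ler0n.
  - by move=> v; rewrite /w orbb; case: (boolP (F v v)) => [/Fs/andP[->]//|]; rewrite mul0r.
  - move=> u v vX; rewrite /w [_ || _](_ : _ = false) ?mul0r //; apply: contraNF vX.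
    by move=> /orP[]/FAB/andP[aA bB]; rewrite inE ?aA ?bB ?orbT.
  - by move=> v; rewrite wdegE ler_pdivrMr // mul1r ler_nat; case: ifP.
have def_le (S S' : {set V}) : S' \subset S -> (forall v, v \in S' -> deficit w v = 0) ->
    \sum_(v in S) deficit w v <= #|S|%:R - #|S'|%:R.
  move=> S'S def0; rewrite (big_setID S') /= big1 ?add0r; last first.
    by move=> v; rewrite inE => /andP[_ /def0].
  have -> : #|S|%:R - #|S'|%:R = #|S :\: S'|%:R :> R.
    by rewrite -(cardsID S' S) (setIidPr S'S) natrD addrC addKr.
  rewrite -sum1_card natr_sum; apply: ler_sum => v _.
  by case/andP: (deficit_bounds v wX).
have dA v : v \in A' -> deficit w v = 0.
  move=> vA; have vs : v \in s by rewrite (subsetP As) // (subsetP A'A).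
  by rewrite /deficit wdegE vs regA // divff ?subrr // gt_eqF.
have dB v : v \in B' -> deficit w v = 0.
  move=> vB; have vs : v \notin s by rewrite notB // (subsetP B'B).
  by rewrite /deficit wdegE (negbTE vs) regB // divff ?subrr // gt_eqF.
have disj : [disjoint A0 & B0].
  by rewrite disjoint_sym; apply: disjointWr Bs.
have cardX : #|X|%:R = 2 * #|A0|%:R :> R.
  by rewrite /X cardsU disjoint_setI0 // cards0 subn0 -eAB natrD; ring.
have A0pos : 0 < #|A0|%:R :> R by rewrite ltr0n card_gt0.
have defX : \sum_(v in X) deficit w v < 1 / 8 * #|X|%:R.
  rewrite (eq_bigl [predU A0 & B0]) => [|v]; last by rewrite !inE.
  rewrite bigU //= cardX; have := def_le A0 A' A'A dA; have := def_le B0 B' B'B dB.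
  have : 15 * #|A0|%:R <= 16 * #|A'|%:R :> R by rewrite -!natrM ler_nat.
  rewrite -eA'B' -eAB; move: (\sum_(v in A0) _) (\sum_(v in B0) _) => a b.
  by move: A0pos; move: (#|A0|%:R) (#|A'|%:R) => n n'; lra.
have [w1 [X1 [X10 w1X1 max1 def1 w01]]] := cleaning wX defX.
have c0 : 0 < t%:R^-1 :> R by rewrite invr_gt0.
have cle : t%:R^-1 * 500 * 500 <= 1 :> R by rewrite -mulrA mulrC ler_pdivrMr // mul1r.
have [w2 [X2 [X20 w2X2 def2 w12]]] := regularisation c0 cle X10 w1X1 max1 def1.
have nz u v : w2 u v != 0 -> F u v || F v u.
  by apply: contraR => /negbTE nF; rewrite w12 // w01 // /w nF mul0r.
have [|||E [E0 Es outE inE']] :=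
  @biregular_relation R V s w2 X2 _ _ k r rk X20 w2X2 def2.
- by move=> u v /nz /orP[]/Fs/andP[-> /negbTE ->].
- rewrite mulrA ler_pdivrMr // mul1r; apply: le_trans (ltW tk).
  by apply: ler_wpM2l => //; rewrite -[leLHS]mul1r ler_wpM2r // ler1n.
- by rewrite !mulrA ltr_pdivrMr // mul1r -mulrA.
exists E; split=> // a b Eab; have /and3P[as_ bs w2ab] := Es a b Eab.
rewrite as_ bs; case/orP: (nz a b w2ab) => // /Fs.
by rewrite (negbTE bs).
Qed.

(** * Bipartite subgraphs of large minimum degree *)

(** In a maximum cut, moving one vertex across gains nothing. A set and its complement cut equally,
    so [side] treats both sides. *)
Lemma max_cut (V : finType) (e : rel V) : symmetric e -> irreflexive e ->
  exists s : {set V}, forall v,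
  (#|[set u | e v u]| <= 2 * #|[set u | e v u && ((u \in s) != (v \in s))]|)%N.
Proof.
move=> esym eirr.
pose c (s : {set V}) := (\sum_(a in s) \sum_(b in ~: s) e a b)%N.
have cC s : c (~: s) = c s.
  rewrite /c exchange_big setCK; apply: eq_bigr => a _; apply: eq_bigr => b _.
  by rewrite esym.
pose P (s : {set V}) := true.
have P0 : P set0 by [].
case: (arg_maxnP c P0) => s _ maxs; exists s.
have side (s' : {set V}) v : (forall s1, c s1 <= c s')%N -> v \in s' ->
    (#|[set u | e v u & u \in s']| <= #|[set u | e v u & u \notin s']|)%N.
  move=> max' vs; have := max' (s' :\ v).
  have sC : ~: (s' :\ v) = v |: ~: s' by apply/setP => u; rewrite !inE negb_and negbK.
  have vC : v \notin ~: s' by rewrite inE negbK.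
  rewrite /c [in X in (_ <= X)%N](big_setD1 v vs) /= sC.
  under eq_bigr => a _ do rewrite big_setU1 //=.
  rewrite big_split /= leq_add2r.
  under eq_bigr => a _ do rewrite esym.
  have cnt (S : {set V}) : (\sum_(b in S) e v b)%N = #|[set u | e v u & u \in S]|.
    rewrite -sum1_card big_mkcond [RHS]big_mkcond; apply: eq_bigr => u _.
    by rewrite inE andbC; case: (u \in S); case: (e v u).
  rewrite !cnt; congr (_ <= _)%N; apply: eq_card => u; rewrite !inE //.
  by case: eqP => // ->; rewrite eirr.
move=> v; have max_s s1 : (c s1 <= c s)%N by apply: maxs.
have split_s : #|[set u | e v u]| =
    (#|[set u | e v u & u \in s]| + #|[set u | e v u & u \notin s]|)%N.
  rewrite -(cardsID s); congr (_ + _)%N; apply: eq_card => u; rewrite !inE //.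
  by rewrite andbC.
have cutE : [set u | e v u && ((u \in s) != (v \in s))] =
    if v \in s then [set u | e v u & u \notin s] else [set u | e v u & u \in s].
  by apply/setP => u; case: (v \in s); rewrite !inE; case: (u \in s).
rewrite cutE split_s; case: ifP => vs.
  by have := side s v max_s vs; lia.
have {}vs : v \in ~: s by rewrite inE vs.
have max_sC s1 : (c s1 <= c (~: s))%N by rewrite cC.
have := side (~: s) v max_sC vs.
have -> : [set u | e v u & u \in ~: s] = [set u | e v u & u \notin s].
  by apply/setP => u; rewrite !inE.
have -> : [set u | e v u & u \notin ~: s] = [set u | e v u & u \in s].
  by apply/setP => u; rewrite !inE negbK.
lia.
Qed.

(** In a minimal set of average degree above [2 * D], deleting a vertex of degree at most [D] would
    not lower the average to [2 * D]. *)
Lemma min_degree (V : finType) (e : rel V) (X0 : {set V}) D :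
  symmetric e -> irreflexive e ->
  (2 * D * #|X0| < \sum_(v in X0) #|[set u in X0 | e v u]|)%N ->
  exists X : {set V}, [/\ X != set0, X \subset X0 &
    forall v, v \in X -> (D < #|[set u in X | e v u]|)%N].
Proof.
move=> esym eirr.
pose f (X : {set V}) := (\sum_(v in X) #|[set u in X | e v u]|)%N.
pose P (X : {set V}) := (X \subset X0) && (2 * D * #|X| < f X)%N.
move=> ltX0; have PX0 : P X0 by rewrite /P subxx.
case: (arg_minnP (fun X : {set V} => #|X|) PX0) => X /andP[XX0 ltX] minX.
exists X; split=> //.
  by apply: contraTneq ltX => ->; rewrite /f big_set0.
move=> v vX; rewrite ltnNge; apply/negP => leD.
have fX : f X = (f (X :\ v) + 2 * #|[set u in X | e v u]|)%N.
  rewrite /f (big_setD1 v vX) /= mul2n -addnn addnCA; congr (_ + _)%N.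
  have -> : #|[set u in X | e v u]| = (\sum_(u in X :\ v) e u v)%N.
    rewrite -sum1_card big_mkcond [RHS]big_mkcond; apply: eq_bigr => u _.
    rewrite !inE esym; case: eqP => [->|_]; first by rewrite eirr andbF.
    by case: (u \in X); case: (e u v).
  rewrite -big_split; apply: eq_bigr => u _.
  rewrite (cardsD1 v) !inE vX /= addnC; congr (_ + _)%N.
  by apply: eq_card => x; rewrite !inE andbA.
have : P (X :\ v).
  rewrite /P (subset_trans (subD1set _ _)) //=.
  move: ltX; rewrite fX (cardsD1 v X) vX; nia.
by move/minX; rewrite (cardsD1 v X) vX ltnn.
Qed.

(** * The theorem *)

(** Bernoulli's inequality gives [(1 + 1/m)^m >= 2]; this is its [L]-th power with denominators
    cleared. *)
Lemma bernoulli_doubling m L : (0 < m)%N -> (2 ^ L * m ^ (m * L) <= m.+1 ^ (m * L))%N.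
Proof.
move=> m0; have step k : (m ^ k * (m + k) <= m * m.+1 ^ k)%N.
  elim: k => [|k IHk]; first by rewrite !expn0 addn0 mul1n muln1.
  rewrite !expnS; move: (m ^ k)%N (m.+1 ^ k)%N IHk => a b; nia.
rewrite !expnM -expnMn; have [->|L0] := posnP L; first by rewrite !expn0.
rewrite leq_exp2r // -(leq_pmul2l m0); apply: leq_trans (step m).
by move: (m ^ m)%N => a; nia.
Qed.

Lemma regular_subgraph_of_dense (R : archiRealFieldType) (T r L : nat) (V : finType)
    (G : sgraph V) :
  (0 < r)%N -> (0 < L)%N -> 500 * 500 <= T%:R :> R -> (#|vertices G| <= r * 2 ^ L)%N ->
  (69 * T * r * L * #|vertices G| <= \sum_(x in vertices G) degree G x)%N ->
  exists H : sgraph V, subgraph H G /\ regular r H.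
Proof.
move=> r0 L0 T500 leV leE.
have T0 : (0 < T)%N by rewrite -(ltr0n R); apply: lt_le_trans T500; rewrite mulr_gt0.
have [s0 cut0] := max_cut (@adj_sym _ G) (@adj_irr _ G).
pose e u v := adj G u v && ((u \in s0) != (v \in s0)).
have esym : symmetric e by move=> u v; rewrite /e adj_sym eq_sym.
have eirr : irreflexive e by move=> u; rewrite /e adj_irr.
have eG u v : e u v -> adj G u v by case/andP.
(* The degree pays for [15 * L] blocks of [t] matchings with [r] to spare. The cut and the passage
   to minimum degree each cost a factor 2, and [4 * D] is below [69 * T * r * L]. *)
pose t := (T * r)%N; pose D := (r + 15 * L * t)%N.
have degE : (2 * D * #|vertices G| < \sum_(v in vertices G) #|[set u in vertices G | e v u]|)%N.
  have le2 : (\sum_(x in vertices G) degree G x <=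
      2 * \sum_(v in vertices G) #|[set u in vertices G | e v u]|)%N.
    rewrite big_distrr /=; apply: leq_sum => v _; apply: leq_trans (cut0 v) _.
    rewrite leq_mul2l /=; apply/subset_leq_card/subsetP => u; rewrite !inE => /andP[vu cuv].
    have /andP[_ ->] := adj_vertices vu.
    by rewrite /e vu eq_sym.
  have V0 : (0 < #|vertices G|)%N by rewrite card_gt0 vertices_neq0.
  have leD : (4 * D < 69 * T * r * L)%N.
    have : (0 < T * r * L)%N by rewrite !muln_gt0 T0 r0.
    have : (r <= T * r * L)%N by rewrite mulnAC leq_pmull // muln_gt0 T0.
    have -> : (4 * D = 4 * r + 60 * (T * r * L))%N by rewrite /D /t; ring.
    have -> : (69 * T * r * L = 69 * (T * r * L))%N by ring.
    by move: (T * r * L)%N => m; lia.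
  have : (4 * D * #|vertices G| < 69 * T * r * L * #|vertices G|)%N by rewrite ltn_pmul2r.
  move: (#|vertices G|) (69 * T * r * L)%N (D) leE le2 => n m d leE le2; nia.
have [X [X0 XG degX]] := min_degree esym eirr degE.
have [s leB es] : exists2 s : {set V}, (#|X :\: s| <= #|X :&: s|)%N &
    forall u v, e u v -> (u \in s) != (v \in s).
  have [le|lt] := leqP #|X :\: s0| #|X :&: s0|; first by exists s0 => // u v /andP[].
  exists (~: s0); first by rewrite setDE setCK -setDE ltnW.
  by move=> u v /andP[_]; rewrite !inE; case: (u \in s0); case: (v \in s0).
pose A := X :&: s; pose B := X :\: s.
pose E : rel V := fun a b => [&& e a b, a \in A & b \in B].
have outE a : a \in A -> (D < outdeg E a)%N.
  move=> aA; have /setIP[aX as_] := aA; apply: leq_trans (degX a aX) _.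
  apply/subset_leq_card/subsetP => u; rewrite inE => /andP[uX eau].
  by rewrite inE /E eau aA /= inE uX andbT; have := es _ _ eau; rewrite as_; case: (u \in s).
have A0 : A != set0.
  rewrite -card_gt0; move: X0; rewrite -card_gt0 -(cardsID s X).
  by move: leB; rewrite -/A -/B; lia.
have nbrE : nbr E A \subset B by apply/subsetP => b /nbrP[a _ /and3P[]].
(* A first perfect matching makes the two sides equally large. *)
have [||A1 [f [A10 A1A finj fE fA1]]] := @perfect_matching _ E A A0.
- exact: leq_trans (subset_leq_card nbrE) leB.
- by move=> a /outE; apply: leq_trans.
have degA1 a : a \in A1 -> (r.+1 + 15 * L * t <= outdeg E a)%N.
  by move=> aA1; have := outE a (subsetP A1A a aA1); rewrite /D addSn.
have cardA1 : #|A1| = #|nbr E A1| by rewrite -fA1 card_in_imset.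
have [[F [A0' [B0' [A' [B' [[P1 P2 P3 P4 P5] [Q1 Q2 P6] P7 [P8 P9] [P10 P11]]]]]]]|] :=
    almost_regular_block A10 cardA1 (subxx _) degA1 (ltn0Sn r); last first.
  (* If no block is good, [(16/15)^(15 * L) * (r + 1) <= #|A1| <= r * 2 ^ L], against
     [(16/15)^(15 * L) >= 2 ^ L]. *)
  have leA1 : (#|A1| <= r * 2 ^ L)%N.
    apply: leq_trans leV; apply: subset_leq_card.
    by rewrite (subset_trans A1A) // (subset_trans (subsetIl _ _)).
  have : (2 ^ L * 15 ^ (15 * L) <= 16 ^ (15 * L))%N := @bernoulli_doubling 15 L isT.
  have : (0 < 2 ^ L)%N by rewrite expn_gt0.
  have : (0 < 15 ^ (15 * L))%N by rewrite expn_gt0.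
  move: (15 ^ (15 * L))%N (16 ^ (15 * L))%N (2 ^ L)%N leA1 => a b c leA1 a0 c0 le1 le2.
  suff : (a * c * r.+1 <= a * c * r)%N.
    by rewrite leq_pmul2l ?muln_gt0 ?a0 // ltnn.
  rewrite -[leqRHS]mulnA [(c * r)%N]mulnC [(a * c)%N]mulnC.
  apply: leq_trans (leq_mul le1 (leqnn _)) _; apply: leq_trans le2 _.
  by rewrite leq_mul2l leA1 orbT.
have [k /andP[rk kr]] : exists k, (r <= 2 ^ k <= 2 * r)%N.
  exists (trunc_log 2 r).+1; have /andP[lo hi] := trunc_log_bounds (isT : 1 < 2)%N r0.
  by rewrite ltnW // expnS leq_mul2l.
have FE a b : F a b -> E a b by move/P7/and3P => [].
have FAB a b : F a b -> (a \in A0') && (b \in B0') by move/P7/and3P => [_ -> ->].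
have A0s : A0' \subset s.
  by rewrite (subset_trans Q1) // (subset_trans A1A) // subsetIr.
have B0s : [disjoint B0' & s].
  have Q3 : B0' \subset B by apply: subset_trans Q2 (subset_trans _ nbrE); apply: nbrS.
  by rewrite disjoint_subset; apply: subset_trans Q3 _; apply/subsetP => b /setDP[].
have T500' : 500 * 500 <= t%:R :> R.
  by apply: le_trans T500 _; rewrite ler_nat leq_pmulr.
(* Here [2 * 2 ^ k - 1 <= 4 * r], and [4 * 128 * 11] is below [500 * 500]. *)
have tk : (2 * 2 ^ k - 1)%:R * (128 * 11) < t%:R :> R.
  have le4r : (2 * 2 ^ k - 1)%:R <= 4 * r%:R :> R.
    have : (2 * 2 ^ k - 1 <= 4 * r)%N by move: (2 ^ k)%N kr => q; clear; lia.
    by rewrite -(ler_nat R) natrM.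
  have r0' : 0 < r%:R :> R by rewrite ltr0n.
  have h := ler_wpM2r (ltW r0') T500.
  rewrite /t natrM; move: h le4r r0'.
  move: ((2 * 2 ^ k - 1)%N%:R : R) (T%:R * r%:R : R) (r%:R : R) => a b c; clear; lra.
have rk' : (0 < r <= 2 ^ k)%N by rewrite r0.
have [E' [E'0 E's outE' inE']] := biregular_of_block P1 P2 P3 P4 P5 P6 A0s B0s FAB P8 P9
  P10 P11 rk' T500' tk.
apply: (@regular_subgraph_of_relation _ _ s E' r r0 E'0 _ outE' inE') => a b.
by case/E's/and3P => -> -> /FE/and3P[/eG].
Qed.

(** The logarithm is at least 1 because [r <= n / 2], so rounding it up at most doubles it. *)
Lemma log2_exponent (R : realType) (n r : nat) : (0 < r)%N -> r%:R <= n%:R / 2 :> R ->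
  exists L, [/\ (0 < L)%N, (n <= r * 2 ^ L)%N & L%:R <= 2 * log2 (n%:R / r%:R) :> R].
Proof.
move=> r0 rn; have r0' : 0 < r%:R :> R by rewrite ltr0n.
have ln2 : 0 < ln 2 :> R by rewrite ln_gt0 // ltr1n.
have ge2 : 2 <= n%:R / r%:R :> R by rewrite ler_pdivlMr // mulrC -ler_pdivlMr.
have x0 : 0 < n%:R / r%:R :> R by apply: lt_le_trans ge2.
have log1 : 1 <= log2 (n%:R / r%:R) :> R.
  by rewrite /log2 ler_pdivlMr // mul1r ler_ln // posrE.
have log0 : 0 <= log2 (n%:R / r%:R) :> R by apply: le_trans log1.
exists (Num.truncn (log2 (n%:R / r%:R) : R)).+1; have /andP[lo hi] := truncn_itv log0.
split=> //.
  set L := (Num.truncn _).+1 in hi *.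
  have : n%:R / r%:R <= 2 ^+ L :> R.
    rewrite -ler_ln ?posrE ?exprn_gt0 // lnXn // -[leRHS]mulr_natl -ler_pdivrMr //.
    exact: ltW.
  by rewrite ler_pdivrMr // -natrX -natrM ler_nat mulnC.
by rewrite -natr1; lra.
Qed.

Theorem theorem1p5 (R : realType) :
  exists C : R, forall r n : nat,
    (0 < r)%N -> (0 < n)%N -> r%:R <= n%:R / 2 :> R ->
    forall (V : finType) (G : sgraph V),
      #|vertices G| = n ->
      C * r%:R * log2 (n%:R / r%:R) <= average_degree R G ->
      exists H : sgraph V, subgraph H G /\ regular r H.
Proof.
have [T T500] : exists T : nat, 500 * 500 <= T%:R :> R.
  by exists (Num.bound (500 * 500 : R)); apply/ltW/archi_boundP; rewrite mulr_ge0.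
(* 138 is twice 69, since [L] is at most twice the logarithm. *)
exists (138 * T%:R) => r n r0 n0 rn V G Gn avg.
have [L [L0 nL Llog]] := log2_exponent r0 rn.
apply: (regular_subgraph_of_dense r0 L0 T500); first by rewrite Gn.
have n0' : 0 < n%:R :> R by rewrite ltr0n.
rewrite -(ler_nat R) Gn; move: avg; rewrite /average_degree Gn ler_pdivlMr //.
apply: le_trans; rewrite !natrM ler_pM2r //.
have Tr : 0 <= 69 * (T%:R * r%:R) :> R by rewrite !mulr_ge0.
have := ler_wpM2l Tr Llog.
by move: (log2 _) => l; lra.
Qed.
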